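(* Let $\mathcal{H}(T,A,\mu)$ be a Cauchy--de Branges space with $T=\{t_n\}_{n\in\mathbb{N}}$ power separated, $|t_n|\ge 2$ for all $n$, and $A$ of finite order. The following statements are equivalent: (i) $\mathcal{H}(T,A,\mu)$ has the localization property; (ii) there exists an unbounded set $S\subset\mathbb{C}$ such that the set $\mathcal{Z}_f\cap S$ is finite for every nonzero $f\in\mathcal{H}(T,A,\mu)$; (iii) for every $f\in\mathcal{H}(T,A,\mu)\setminus\{0\}$ and every $M>0$, the set $\mathcal{Z}_f\setminus\bigcup_n D(t_n,|t_n|^{-M})$ is finite; (iv) there is no nonzero $f\in\mathcal{H}(T,A,\mu)$ with an infinite number of multiple zeros.
   Context: Cauchy--de Branges space: let $T=\{t_n\}_{n\in\mathbb{N}}$ be a sequence of distinct complex numbers with $|t_n|\to\infty$, let $\mu=\sum_n\mu_n\delta_{t_n}$ with $\mu_n>0$ and $\sum_n\frac{\mu_n}{|t_n|^2+1}<\infty$, and let $A$ be an entire function with only simple zeros whose zero set is exactly $T$. Then $$\mathcal{H}(T,A,\mu)=\Big\{F:\ F(z)=A(z)\sum_n\frac{a_n\mu_n^{1/2}}{z-t_n},\ \{a_n\}\in\ell^2\Big\},\qquad \|F\|=\|\{a_n\}\|_{\ell^2},$$ which is a Hilbert space of entire functions. $T$ is power separated if there exist $C>0$ and $N>0$ such that $\mathrm{dist}(t_n,\{t_m\}_{m\ne n})\ge C|t_n|^{-N}$ for all $n$. For an entire function $f$, $\mathcal{Z}_f$ denotes the set of all zeros of $f$; $D(z,r)$ is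 the open disc with center $z$ and radius $r$. Localization property: $\mathcal{H}(T,A,\mu)$ (with $T$ power separated) has the localization property if there exists a sequence of pairwise disjoint discs $\{D(t_n,r_n)\}_n$ with $r_n\to0$ such that for every nonzero $f\in\mathcal{H}(T,A,\mu)$ the set $\mathcal{Z}_f\setminus\bigcup_nD(t_n,r_n)$ is finite and each disc $D(t_n,r_n)$, except possibly finitely many $n$ (depending on $f$), contains at most one point of $\mathcal{Z}_f$. *)

(* Defs.v *)
From Stdlib Require Export Reals List.
From Coquelicot Require Export Coquelicot.
Open Scope R_scope.

Definition finite_set {X : Type} (P : X -> Prop) : Prop :=
  exists l : list X, forall x, P x -> In x l.

Definition entire (f : C -> C) : Prop :=
  forall z : C, @ex_derive C_AbsRing C_NormedModule f z.

Definition finite_order (f : C -> C) : Prop :=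
  exists K rho : R, forall z : C,
    1 <= Cmod z -> Cmod (f z) <= K * exp (Rpower (Cmod z) rho).

Definition zeros (f : C -> C) (z : C) : Prop := f z = RtoC 0.

(* [C_derive] is a total operator whose value is meaningful only at points of
   differentiability; the two predicates below are applied to entire functions
   which do not vanish identically. *)
Definition simple_zero (f : C -> C) (z : C) : Prop :=
  f z = RtoC 0 /\ C_derive f z <> RtoC 0.

Definition multiple_zero (f : C -> C) (z : C) : Prop :=
  f z = RtoC 0 /\ C_derive f z = RtoC 0.

Definition nonzero (f : C -> C) : Prop := exists z : C, f z <> RtoC 0.

Definition disc (c : C) (r : R) (z : C) : Prop := Cmod (z - c) < r.

Definition unbounded (S : C -> Prop) : Prop :=
  forall B : R, exists z : C, S z /\ B < Cmod z.

(* The data (T, A, mu) of a Cauchy--de Branges space, with T = {t n} and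
   mu = sum_n (mu n) delta_(t n). *)
Record CdB_data (t : nat -> C) (A : C -> C) (mu : nat -> R) : Prop := {
  CdB_distinct : forall m n : nat, m <> n -> t m <> t n;
  CdB_infinity : is_lim_seq (fun n => Cmod (t n)) p_infty;
  CdB_mu_pos : forall n : nat, 0 < mu n;
  CdB_mu_sum : ex_series (fun n => mu n / (Cmod (t n) ^ 2 + 1));
  CdB_entire : entire A;
  CdB_zeros : forall z : C, zeros A z <-> exists n : nat, z = t n;
  CdB_simple : forall z : C, zeros A z -> simple_zero A z
}.

(* Membership in H(T, A, mu). The identity F = A * (Cauchy transform) is between
   meromorphic functions: it is required off the poles t n, and F takes at each
   t n the value given by removing the singularity, which is what the
   requirement that F be entire says. *)
Definition CdB_space (t : nat -> C) (A : C -> C) (mu : nat -> R)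
    (F : C -> C) : Prop :=
  entire F /\
  exists a : nat -> C,
    ex_series (fun n => Cmod (a n) ^ 2) /\
    forall z : C, (forall n : nat, z <> t n) ->
      exists s : C,
        @is_series C_AbsRing C_NormedModule
          (fun n => (a n * RtoC (sqrt (mu n)) / (z - t n))%C) s /\
        F z = (A z * s)%C.

(* The lower bound on dist(t n, {t m : m <> n}), an infimum, is spelled out as
   a lower bound on all the distances. *)
Definition power_separated (t : nat -> C) : Prop :=
  exists K N : R, 0 < K /\ 0 < N /\
    forall n m : nat, m <> n ->
      K * Rpower (Cmod (t n)) (- N) <= Cmod (t n - t m).

Definition localization_property (t : nat -> C) (A : C -> C)
    (mu : nat -> R) : Prop :=
  exists r : nat -> R,
    (forall n : nat, 0 < r n) /\
    (forall m n : nat, m <> n ->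
       forall z : C, ~ (disc (t m) (r m) z /\ disc (t n) (r n) z)) /\
    is_lim_seq r 0 /\
    forall f : C -> C, CdB_space t A mu f -> nonzero f ->
      finite_set (fun z => zeros f z /\ ~ exists n : nat, disc (t n) (r n) z) /\
      finite_set (fun n : nat =>
        ~ forall z w : C, zeros f z -> disc (t n) (r n) z ->
                          zeros f w -> disc (t n) (r n) w -> z = w).

(* Main.v *)
Require Import Defs.
From Stdlib Require Import Lra Lia ClassicalEpsilon FunctionalExtensionality.

(** The proof goes around the cycle (i) => (ii) => (iv) => (iii) => (i). For the first
    step take [S = {t_n + r_n}]: boundary points of the disjoint discs lie in none of them.
    In the other steps a function [f] violating the conclusion is turned into a function
    [g] violating the hypothesis, by moving infinitely many zeros of [f].

    On the side of the Cauchy transform [C_x(z) = sum_k x_k / (z - t_k)], having zeros at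
    [z_1, ..., z_p] means that [x_k = q_k prod_i (t_k - z_i)] with [sum_k q_k t_k^j = 0] for
    [j < p], and then [C_x = C_q prod_i (z - z_i)]. So replacing [z_i] by other points
    only multiplies [x_k] by a rational function of [t_k], and no growth theory is involved.

    The zeros are moved in pairs [z, w] to [t_n, s], where [t_n] is the only pole which may
    be close to [z] or [w] and [s] is arbitrary. The multiplier
    [m(t) = (1 - t/t_n)(1 - t/s) / ((1 - t/z)(1 - t/w))] vanishes at [t_n], so that
    closeness does no harm; by power separation [m(t_k) = O(|t_k|^(2N+4))] uniformly in the
    pair, and [m -> 1] pointwise as the pair goes to infinity. Once [2N+5] pairs
    have been moved to a single point each, the weights decay like [|t_k|^(-2N-5)], which
    makes the products of the subsequent multipliers converge uniformly in [k] if the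
    pairs are sparse enough. *)

(** * Complex series and derivatives *)

(** The target [s] distinguishes the implications. For (ii) => (iv) it is a point of the given set
    [S], and each pair is a double zero counted twice. For (iv) => (iii) it is [t_n] itself, so that
    two zeros far from all poles merge into a double zero at [t_n]. For (iii) => (i) it is the
    boundary point [t_n + r_n], and the pair consists of two zeros in one disc. The obstacle is that
    a multiplier close to 1 on bounded sets need not be close to 1 at all poles: its two numerators
    contribute one power of [|t_k|] each and its two denominators [N+1] powers each, which gives the
    exponent [2N+4]. Moving a pair to a single point costs one degree in the numerator and so yields
    a factor [O(1/|t_k|)]; with [2N+5] such factors the growth is beaten by one power, and this
    power makes the corrections small at all poles beyond some radius. The remaining poles are
    handled by taking the pair far away. *)

Lemma Cmod_sub_sym (x y : C) : Cmod (x - y) = Cmod (y - x).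
Proof. rewrite <- Cmod_opp. f_equal. ring. Qed.

Lemma Cmod_sub_le (x y : C) : Cmod (x - y) <= Cmod x + Cmod y.
Proof. unfold Cminus. rewrite <- (Cmod_opp y). apply Cmod_triangle. Qed.

Lemma Cmod_sub_ge (x y : C) : Cmod x - Cmod y <= Cmod (x - y).
Proof.
  assert (H := Cmod_triangle (x - y) y).
  replace (x - y + y)%C with x in H by ring. lra.
Qed.

Lemma Cmod_sub_pos (x y : C) : x <> y -> 0 < Cmod (x - y).
Proof.
  intro H. apply Cmod_gt_0. intro E. apply H.
  replace x with (x - y + y)%C by ring. rewrite E. ring.
Qed.

Lemma Csub_neq_0 (x y : C) : x <> y -> (x - y)%C <> RtoC 0.
Proof. intro H. apply Cmod_gt_0. now apply Cmod_sub_pos. Qed.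

Lemma Csub_eq_0 (x y : C) : (x - y)%C = RtoC 0 -> x = y.
Proof. intro H. apply NNPP. intro N. now apply (Csub_neq_0 x y N). Qed.

Lemma Cinv_0 : (/ RtoC 0)%C = RtoC 0.
Proof. unfold Cinv, RtoC; simpl. f_equal; unfold Rdiv; ring. Qed.

Lemma Cmod_Cinv (x : C) : Cmod (/ x) = / Cmod x.
Proof.
  destruct (classic (x = RtoC 0)) as [->|H].
  - now rewrite Cinv_0, Cmod_0, Rinv_0.
  - now apply Cmod_inv.
Qed.

Lemma Cmult_integral (x y : C) : (x * y)%C = RtoC 0 -> x = RtoC 0 \/ y = RtoC 0.
Proof.
  intro H. destruct (classic (x = RtoC 0)) as [?|N]; [now left|right].
  replace y with (/ x * (x * y))%C by (field; exact N). rewrite H. ring.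
Qed.

Notation Cseries := (@is_series C_AbsRing C_NormedModule).
Notation Cderiv := (@is_derive C_AbsRing C_NormedModule).

Lemma Cseries_plus (u v : nat -> C) (a b : C) :
  Cseries u a -> Cseries v b -> Cseries (fun k => (u k + v k)%C) (a + b)%C.
Proof. exact (is_series_plus u v a b). Qed.

Lemma Cseries_scal (c : C) (u : nat -> C) (a : C) :
  Cseries u a -> Cseries (fun k => (c * u k)%C) (c * a)%C.
Proof. exact (is_series_scal c u a). Qed.

Lemma Cseries_ext (u v : nat -> C) (a : C) :
  (forall k, u k = v k) -> Cseries u a -> Cseries v a.
Proof. exact (is_series_ext u v a). Qed.

Lemma Cseries_unique (u : nat -> C) (a b : C) :
  Cseries u a -> Cseries u b -> a = b.
Proof.
  intros Ha Hb.
  exact (@filterlim_locally_unique nat C_AbsRing C_NormedModule eventually _ _ a b Ha Hb).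
Qed.

Definition asum (u : nat -> C) : Prop := ex_series (fun k => Cmod (u k)).

(** Choosing the sum by [epsilon] makes it a total function, so that Cauchy transforms can be
    written down before their convergence is known; the value is arbitrary for divergent series. *)
Definition csum (u : nat -> C) : C := epsilon (inhabits (RtoC 0)) (Cseries u).

Lemma csum_unique (u : nat -> C) (a : C) : Cseries u a -> csum u = a.
Proof.
  intro H. apply (Cseries_unique u); [|exact H].
  unfold csum. apply epsilon_spec. now exists a.
Qed.

Lemma csum_correct (u : nat -> C) : asum u -> Cseries u (csum u).
Proof.
  intro H. unfold csum. apply epsilon_spec.
  apply (@ex_series_le C_AbsRing C_CompleteNormedModule u (fun k => Cmod (u k))).
  - intro k. apply Rle_refl.
  - exact H.
Qed.

Lemma csum_ext (u v : nat -> C) : (forall k, u k = v k) -> csum u = csum v.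
Proof. intro H. assert (u = v) as -> by (now apply functional_extensionality). reflexivity. Qed.

Lemma Cderiv_iff (f : C -> C) (v l : C) :
  Cderiv f v l <->
  forall eps, 0 < eps -> exists d, 0 < d /\ forall y, Cmod (y - v) < d ->
    Cmod (f y - f v - (y - v) * l) <= eps * Cmod (y - v).
Proof.
  split.
  - intros [_ H] eps He.
    specialize (H v (fun P HP => HP) (mkposreal eps He)).
    destruct H as [d Hd]. exists d. split; [apply cond_pos|].
    intros y Hy. apply Hd. exact Hy.
  - intro H. split; [apply is_linear_scal_l|].
    intros x Hx eps.
    assert (x = v) as -> by
      (symmetry; apply (@is_filter_lim_locally_unique C_AbsRing (AbsRing_NormedModule C_AbsRing) v x Hx)).
    destruct (H eps (cond_pos eps)) as [d [Hd H']].
    exists (mkposreal d Hd). intros y Hy.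
    now apply H'.
Qed.

Lemma Cderiv_ext_loc (f g : C -> C) (v l : C) (d : R) :
  0 < d -> (forall y, Cmod (y - v) < d -> f y = g y) -> Cderiv f v l -> Cderiv g v l.
Proof.
  intros Hd H. rewrite !Cderiv_iff. intros Hf eps He.
  destruct (Hf eps He) as [d' [Hd' Hf']].
  exists (Rmin d d'). split; [now apply Rmin_pos|].
  intros y Hy.
  rewrite <- (H y), <- (H v).
  - apply Hf'. eapply Rlt_le_trans; [exact Hy|apply Rmin_r].
  - replace (v - v)%C with (RtoC 0) by ring. rewrite Cmod_0. exact Hd.
  - eapply Rlt_le_trans; [exact Hy|apply Rmin_l].
Qed.

Lemma Cderiv_unique (f : C -> C) (v l m : C) : Cderiv f v l -> Cderiv f v m -> l = m.
Proof.
  intros Hl Hm. apply is_C_derive_unique in Hl. apply is_C_derive_unique in Hm. congruence.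
Qed.

Lemma Cderiv_plus (f g : C -> C) (v l m : C) :
  Cderiv f v l -> Cderiv g v m -> Cderiv (fun z => f z + g z)%C v (l + m)%C.
Proof. exact (is_derive_plus f g v l m). Qed.

(** With [r] and [s] the remainders of [f] and [g], the error is [r * g v + f v * s] plus the
    product of the two increments; the latter is of second order in [y - v]. *)
Lemma Cderiv_mult (f g : C -> C) (v l m : C) :
  Cderiv f v l -> Cderiv g v m ->
  Cderiv (fun z => f z * g z)%C v (l * g v + f v * m)%C.
Proof.
  rewrite !Cderiv_iff. intros Hf Hg.
  set (B := Cmod (f v) + Cmod (g v) + Cmod l + Cmod m + 1).
  assert (P1 := Cmod_ge_0 (f v)). assert (P2 := Cmod_ge_0 (g v)).
  assert (P3 := Cmod_ge_0 l). assert (P4 := Cmod_ge_0 m).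
  assert (HB : 1 <= B) by (unfold B; lra).
  intros eps He.
  set (e := Rmin 1 (eps / (4 * B))).
  assert (He0 : 0 < e).
  { apply Rmin_pos; [lra|]. apply Rdiv_lt_0_compat; nra. }
  assert (He1 : e <= 1) by apply Rmin_l.
  assert (He2 : 4 * B * e <= eps).
  { assert (e <= eps / (4 * B)) by apply Rmin_r.
    apply Rmult_le_compat_l with (r := 4 * B) in H; [|lra].
    replace (4 * B * (eps / (4 * B))) with eps in H by (field; lra). exact H. }
  destruct (Hf e He0) as [d1 [Hd1 Hf1]]. destruct (Hg e He0) as [d2 [Hd2 Hg1]].
  (* Both increments are at most [(B + 1) * h]; this radius makes their product at most [e * h]. *)
  set (d3 := e / ((B + 1) * (B + 1))).
  assert (Hd3 : 0 < d3) by (apply Rdiv_lt_0_compat; nra).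
  exists (Rmin d3 (Rmin d1 d2)). split; [repeat apply Rmin_pos; assumption|].
  intros y Hy.
  assert (Hy3 : Cmod (y - v) < d3) by (eapply Rlt_le_trans; [exact Hy|apply Rmin_l]).
  assert (Hy1 : Cmod (y - v) < d1).
  { eapply Rlt_le_trans; [exact Hy|]. eapply Rle_trans; [apply Rmin_r|apply Rmin_l]. }
  assert (Hy2 : Cmod (y - v) < d2).
  { eapply Rlt_le_trans; [exact Hy|]. eapply Rle_trans; [apply Rmin_r|apply Rmin_r]. }
  specialize (Hf1 y Hy1). specialize (Hg1 y Hy2).
  set (h := Cmod (y - v)) in *. assert (Hh : 0 <= h) by apply Cmod_ge_0.
  set (r := (f y - f v - (y - v) * l)%C) in *.
  set (s := (g y - g v - (y - v) * m)%C) in *.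
  replace (f y * g y - f v * g v - (y - v) * (l * g v + f v * m))%C
    with (r * g v + f v * s + (r + (y - v) * l) * (s + (y - v) * m))%C
    by (unfold r, s; ring).
  assert (Hr : Cmod (r + (y - v) * l) <= (B + 1) * h).
  { eapply Rle_trans; [apply Cmod_triangle|]. rewrite Cmod_mult. fold h.
    assert (Cmod l <= B) by (unfold B; lra). nra. }
  assert (Hs : Cmod (s + (y - v) * m) <= (B + 1) * h).
  { eapply Rle_trans; [apply Cmod_triangle|]. rewrite Cmod_mult. fold h.
    assert (Cmod m <= B) by (unfold B; lra). nra. }
  eapply Rle_trans; [apply Cmod_triangle|].
  eapply Rle_trans; [apply Rplus_le_compat_r, Cmod_triangle|].
  rewrite !Cmod_mult.
  assert (E1 : Cmod r * Cmod (g v) <= e * h * B).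
  { apply Rmult_le_compat; try apply Cmod_ge_0; [assumption|unfold B; lra]. }
  assert (E2 : Cmod (f v) * Cmod s <= B * (e * h)).
  { apply Rmult_le_compat; try apply Cmod_ge_0; [unfold B; lra|assumption]. }
  assert (E3 : Cmod (r + (y - v) * l) * Cmod (s + (y - v) * m) <= (B + 1) * h * ((B + 1) * h)).
  { apply Rmult_le_compat; try apply Cmod_ge_0; assumption. }
  assert (E4 : (B + 1) * (B + 1) * h <= e).
  { apply Rlt_le. apply Rmult_lt_compat_l with (r := (B + 1) * (B + 1)) in Hy3; [|nra].
    unfold d3 in Hy3. replace ((B + 1) * (B + 1) * (e / ((B + 1) * (B + 1)))) with e in Hy3
      by (field; lra). exact Hy3. }
  assert (E5 : (B + 1) * h * ((B + 1) * h) <= e * h) by nra.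
  assert (0 <= e * h) by nra.
  assert (e * h <= e * h * B) by nra.
  assert (4 * B * e * h <= eps * h) by (apply Rmult_le_compat_r; lra).
  lra.
Qed.

Lemma Cderiv_const (c v : C) : Cderiv (fun _ => c) v (RtoC 0).
Proof.
  apply Cderiv_iff. intros eps He. exists 1. split; [lra|]. intros y _.
  replace (c - c - (y - v) * RtoC 0)%C with (RtoC 0) by ring.
  rewrite Cmod_0. apply Rmult_le_pos; [lra|apply Cmod_ge_0].
Qed.

Lemma Cderiv_sub (c v : C) : Cderiv (fun z => z - c)%C v (RtoC 1).
Proof.
  apply Cderiv_iff. intros eps He. exists 1. split; [lra|]. intros y _.
  replace (y - c - (v - c) - (y - v) * RtoC 1)%C with (RtoC 0) by ring.
  rewrite Cmod_0. apply Rmult_le_pos; [lra|apply Cmod_ge_0].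
Qed.

Lemma Cderiv_scal (c : C) (f : C -> C) (v l : C) :
  Cderiv f v l -> Cderiv (fun z => c * f z)%C v (c * l)%C.
Proof.
  intro H. assert (E := Cderiv_mult _ _ _ _ _ (Cderiv_const c v) H). simpl in E.
  replace (c * l)%C with (RtoC 0 * f v + c * l)%C by ring. exact E.
Qed.

Lemma Cderiv_quadratic (f : C -> C) (v l : C) (K d : R) :
  0 < d -> 0 <= K ->
  (forall y, Cmod (y - v) < d ->
     Cmod (f y - f v - (y - v) * l) <= K * Cmod (y - v) ^ 2) ->
  Cderiv f v l.
Proof.
  intros Hd HK H. apply Cderiv_iff. intros eps He.
  assert (He' : 0 < eps / (K + 1)) by (apply Rdiv_lt_0_compat; lra).
  exists (Rmin d (eps / (K + 1))). split; [now apply Rmin_pos|].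
  intros y Hy. eapply Rle_trans.
  - apply H. eapply Rlt_le_trans; [exact Hy|apply Rmin_l].
  - assert (Hy' : Cmod (y - v) < eps / (K + 1))
      by (eapply Rlt_le_trans; [exact Hy|apply Rmin_r]).
    assert (P := Cmod_ge_0 (y - v)).
    assert (K * Cmod (y - v) <= eps).
    { apply Rlt_le in Hy'. apply Rmult_le_compat_l with (r := K + 1) in Hy'; [|lra].
      replace ((K + 1) * (eps / (K + 1))) with eps in Hy' by (field; lra). lra. }
    nra.
Qed.

(** * Cauchy transforms and their quotients *)

Lemma series_bound (u : nat -> C) (s : C) (w : nat -> R) :
  Cseries u s -> (forall k, Cmod (u k) <= w k) -> ex_series w -> Cmod s <= Series w.
Proof.
  intros Hs Hw Hex.
  apply (is_lim_seq_le (fun n => Cmod (@sum_n C_AbelianMonoid u n)) (sum_n w) (Cmod s) (Series w)).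
  - intro n. eapply Rle_trans.
    + apply (@norm_sum_n_m C_AbsRing C_NormedModule u 0 n).
    + apply sum_n_m_le. exact Hw.
  - apply (filterlim_comp _ _ _ (sum_n u) Cmod eventually (locally (s : C_NormedModule)) (locally (Cmod s))).
    + exact Hs.
    + apply (@filterlim_norm C_AbsRing C_NormedModule s).
  - apply Series_correct. exact Hex.
Qed.

Lemma asum_dom (u : nat -> C) (w : nat -> R) :
  (forall k, Cmod (u k) <= w k) -> ex_series w -> asum u.
Proof.
  intros H Hw. unfold asum.
  apply (@ex_series_le R_AbsRing R_CompleteNormedModule (fun k => Cmod (u k)) w); [|exact Hw].
  intro k. change (Rabs (Cmod (u k)) <= w k).
  rewrite Rabs_pos_eq; [apply H|apply Cmod_ge_0].
Qed.

Lemma ex_series_dom (u w : nat -> R) (K : R) :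
  (forall k, 0 <= u k <= K * w k) -> ex_series w -> ex_series u.
Proof.
  intros H Hw.
  apply (@ex_series_le R_AbsRing R_CompleteNormedModule u (fun k => K * w k)).
  - intro k. change (Rabs (u k) <= K * w k). rewrite Rabs_pos_eq; apply H.
  - apply (ex_series_scal K w Hw).
Qed.

Lemma is_series_single {K : AbsRing} {V : NormedModule K} (m : nat) (c : V) :
  is_series (fun k => if Nat.eqb k m then c else zero) c.
Proof.
  unfold is_series.
  apply filterlim_ext_loc with (fun _ : nat => c); [|apply filterlim_const].
  exists m. intros n Hn. unfold sum_n.
  rewrite (sum_n_m_Chasles _ 0 m n); [|lia|lia].
  rewrite (sum_n_m_ext_loc _ (fun _ => zero) (S m) n).
  2:{ intros k Hk. destruct (Nat.eqb_spec k m); [lia|reflexivity]. }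
  rewrite sum_n_m_const_zero, plus_zero_r.
  destruct m as [|m].
  - now rewrite sum_n_n.
  - rewrite sum_n_Sm; [|lia].
    rewrite (sum_n_m_ext_loc _ (fun _ => zero) 0 m).
    2:{ intros k Hk. destruct (Nat.eqb_spec k (S m)); [lia|reflexivity]. }
    rewrite sum_n_m_const_zero, plus_zero_l, Nat.eqb_refl. reflexivity.
Qed.

Definition point_seq (t : nat -> C) : Prop :=
  (forall m n, t m = t n -> m = n) /\
  (forall n, 2 <= Cmod (t n)) /\
  (forall B, exists L, forall n, (L <= n)%nat -> B < Cmod (t n)).

Definition off (t : nat -> C) (z : C) : Prop := forall n, z <> t n.

(** Summability of [|x_k| |t_k|^(p-1)], written so that [p = 0] needs no negative exponent. The case
    [p = 0] is what convergence of the Cauchy transform requires, and each division by a zero raises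
    [p] by one. *)
Definition wsum (t : nat -> C) (p : nat) (x : nat -> C) : Prop :=
  ex_series (fun k => Cmod (x k) * Cmod (t k) ^ p / Cmod (t k)).

(* The term with [t k = z], if any, is [x k * / 0 = 0]: at [z = t m] this is the
   Cauchy transform with the pole at [t m] removed. *)
Definition CT (t x : nat -> C) (z : C) : C := csum (fun k => x k / (z - t k))%C.

Definition zap (m : nat) (x : nat -> C) (k : nat) : C :=
  if Nat.eqb k m then RtoC 0 else x k.

Definition lprod (ys : list C) (z : C) : C :=
  fold_right (fun y acc => ((z - y) * acc)%C) (RtoC 1) ys.

(* [Quot t x zs q]: the function [CT t x] vanishes on [zs] and [CT t q] is its
   quotient by [lprod zs]. *)
Definition Quot (t x : nat -> C) (zs : list C) (q : nat -> C) : Prop :=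
  (forall k, x k = (lprod zs (t k) * q k)%C) /\
  wsum t (length zs) q /\
  (forall ys, (length ys < length zs)%nat ->
     Cseries (fun k => q k * lprod ys (t k))%C (RtoC 0)) /\
  (forall z, off t z -> CT t x z = (lprod zs z * CT t q z)%C).

Section Transform.
Context (t : nat -> C) (Ht : point_seq t).

Lemma pt_inj m n : t m = t n -> m = n.
Proof. apply Ht. Qed.

Lemma pt_ge2 n : 2 <= Cmod (t n).
Proof. apply Ht. Qed.

Lemma pt_inf B : exists L, forall n, (L <= n)%nat -> B < Cmod (t n).
Proof. apply Ht. Qed.

Lemma off_or (v : C) : off t v \/ exists m, v = t m.
Proof.
  destruct (classic (exists m, v = t m)) as [H|H]; [now right|left].
  intros n E. apply H. now exists n.
Qed.

Lemma finite_lower (P : nat -> Prop) (g : nat -> R) (L : nat) :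
  (forall k, P k -> 0 < g k) -> exists d, 0 < d /\ forall k, (k < L)%nat -> P k -> d <= g k.
Proof.
  intro H. induction L as [|L [d [Hd IH]]].
  - exists 1. split; [lra|]. intros; lia.
  - destruct (classic (P L)) as [HP|HP].
    + exists (Rmin d (g L)). split; [apply Rmin_pos; auto|].
      intros k Hk HPk. destruct (Nat.eq_dec k L) as [->|].
      * apply Rmin_r.
      * eapply Rle_trans; [apply Rmin_l|apply IH; [lia|assumption]].
    + exists d. split; [exact Hd|]. intros k Hk HPk.
      destruct (Nat.eq_dec k L) as [->|]; [contradiction|]. apply IH; [lia|assumption].
Qed.

(** If [|t_k| > 2|v|], then [|v - t_k| >= |t_k| / 2]; the finitely many other poles different from
    [v] give a positive minimum. The point [v] may itself be a pole. *)
Lemma sep_point (v : C) :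
  exists d, 0 < d <= 1 /\ forall k, t k <> v -> d * Cmod (t k) <= Cmod (v - t k).
Proof.
  destruct (pt_inf (2 * Cmod v)) as [L HL].
  destruct (finite_lower (fun k => t k <> v) (fun k => Cmod (v - t k) / Cmod (t k)) L)
    as [d [Hd H]].
  { intros k Hk. apply Rdiv_lt_0_compat.
    - apply Cmod_sub_pos. congruence.
    - assert (E := pt_ge2 k). lra. }
  assert (Hm : 0 < Rmin d (1 / 2)) by (apply Rmin_pos; lra).
  exists (Rmin d (1 / 2)).
  split; [split; [exact Hm|eapply Rle_trans; [apply Rmin_r|lra]]|].
  intros k Hk. assert (E := pt_ge2 k).
  destruct (Nat.lt_ge_cases k L) as [Hk'|Hk'].
  - specialize (H k Hk' Hk). eapply Rle_trans.
    + apply Rmult_le_compat_r; [lra|]. eapply Rle_trans; [apply Rmin_l|exact H].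
    + right. field. lra.
  - specialize (HL k Hk'). rewrite Cmod_sub_sym.
    assert (G := Cmod_sub_ge (t k) v).
    assert (Rmin d (1 / 2) * Cmod (t k) <= 1 / 2 * Cmod (t k)).
    { apply Rmult_le_compat_r; [lra|apply Rmin_r]. }
    lra.
Qed.

Lemma CT_term_bound (v : C) : exists K, 0 < K /\
  forall (x : nat -> C) k, Cmod (x k / (v - t k)) <= K * (Cmod (x k) / Cmod (t k)).
Proof.
  destruct (sep_point v) as [d [Hd H]].
  exists (/ d). split; [apply Rinv_0_lt_compat; lra|].
  intros x k. assert (E := pt_ge2 k). assert (P := Cmod_ge_0 (x k)).
  unfold Cdiv. rewrite Cmod_mult, Cmod_Cinv.
  destruct (classic (t k = v)) as [<-|N].
  - replace (t k - t k)%C with (RtoC 0) by ring. rewrite Cmod_0, Rinv_0, Rmult_0_r.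
    apply Rmult_le_pos; [left; apply Rinv_0_lt_compat; lra|].
    apply Rdiv_le_0_compat; lra.
  - specialize (H k N).
    replace (/ d * (Cmod (x k) / Cmod (t k))) with (Cmod (x k) * / (d * Cmod (t k)))
      by (field; lra).
    apply Rmult_le_compat_l; [exact P|]. apply Rinv_le_contravar; [nra|exact H].
Qed.

Lemma wsum_0 (x : nat -> C) :
  wsum t 0 x <-> ex_series (fun k => Cmod (x k) / Cmod (t k)).
Proof.
  unfold wsum. split; apply ex_series_ext; intro k; simpl; unfold Rdiv; ring.
Qed.

Lemma CT_asum (x : nat -> C) (z : C) :
  wsum t 0 x -> asum (fun k => x k / (z - t k))%C.
Proof.
  rewrite wsum_0. intro H. destruct (CT_term_bound z) as [K [_ HK]].
  apply (asum_dom _ (fun k => K * (Cmod (x k) / Cmod (t k)))); [apply HK|].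
  exact (ex_series_scal K _ H).
Qed.

Lemma CT_series (x : nat -> C) (z : C) :
  wsum t 0 x -> Cseries (fun k => x k / (z - t k))%C (CT t x z).
Proof. intro H. apply csum_correct. now apply CT_asum. Qed.

Lemma wsum_dom (p p' : nat) (x y : nat -> C) (K : R) :
  (p <= p')%nat -> 0 <= K -> (forall k, Cmod (x k) <= K * Cmod (y k)) ->
  wsum t p' y -> wsum t p x.
Proof.
  intros Hp HK H. apply ex_series_dom with (K := K).
  intro k. assert (E := pt_ge2 k). assert (P := Cmod_ge_0 (x k)).
  assert (0 < / Cmod (t k)) by (apply Rinv_0_lt_compat; lra).
  assert (Q1 : 0 < Cmod (t k) ^ p) by (apply pow_lt; lra).
  assert (Q2 : Cmod (t k) ^ p <= Cmod (t k) ^ p') by (apply Rle_pow; [lra|exact Hp]).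
  unfold Rdiv. split.
  - apply Rmult_le_pos; [|lra]. apply Rmult_le_pos; lra.
  - rewrite <- !Rmult_assoc. apply Rmult_le_compat_r; [lra|].
    apply Rmult_le_compat; [exact P|lra|apply H|exact Q2].
Qed.

Lemma zap_le (m : nat) (x : nat -> C) k : Cmod (zap m x k) <= 1 * Cmod (x k).
Proof.
  unfold zap. destruct (Nat.eqb k m); [rewrite Cmod_0|]; assert (P := Cmod_ge_0 (x k)); lra.
Qed.

Lemma wsum_zap (p m : nat) (x : nat -> C) : wsum t p x -> wsum t p (zap m x).
Proof. apply (wsum_dom p p _ _ 1); [lia|lra|apply zap_le]. Qed.

Lemma zap_same (m : nat) (x : nat -> C) : zap m x m = RtoC 0.
Proof. unfold zap. now rewrite Nat.eqb_refl. Qed.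

Lemma CT_zap (m : nat) (x : nat -> C) (z : C) :
  wsum t 0 x -> CT t x z = (x m / (z - t m) + CT t (zap m x) z)%C.
Proof.
  intro H. apply csum_unique.
  assert (H1 := CT_series (zap m x) z (wsum_zap 0 m x H)).
  assert (H2 := @is_series_single C_AbsRing C_NormedModule m (x m / (z - t m))%C).
  refine (Cseries_ext _ _ _ _ (Cseries_plus _ _ _ _ H2 H1)).
  intro k. unfold zap. change (@zero C_NormedModule) with (RtoC 0).
  destruct (Nat.eqb_spec k m) as [->|]; unfold Cdiv; ring.
Qed.

(** The termwise remainder is [(y - v)^2 x_k / ((v - t_k)^2 (y - t_k))]. For [|y - v| < d] and
    [|t_k| >= 2] one has [|y - t_k| >= d |t_k| / 2], so the remainders sum to [O(|y - v|^2)]. A pole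
    at [v] is allowed if its weight vanishes. *)
Lemma CT_deriv (x : nat -> C) (v : C) :
  wsum t 0 x -> (forall k, t k = v -> x k = RtoC 0) -> exists l, Cderiv (CT t x) v l.
Proof.
  intros H Hv. destruct (sep_point v) as [d [Hd Hsep]].
  assert (H0 := proj1 (wsum_0 x) H).
  (* The derivative is minus the Cauchy transform at [v] of the weights [x_k / (v - t_k)], which are
     again summable in the required sense. *)
  assert (Hy : wsum t 0 (fun k => x k / (v - t k))%C).
  { destruct (CT_term_bound v) as [K [HK HB]].
    apply (wsum_dom 0 0 _ x K); [lia|lra| |exact H].
    intro k. eapply Rle_trans; [apply HB|]. apply Rmult_le_compat_l; [lra|].
    assert (E := pt_ge2 k). assert (P := Cmod_ge_0 (x k)).
    apply Rmult_le_reg_r with (Cmod (t k)); [lra|].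
    replace (Cmod (x k) / Cmod (t k) * Cmod (t k)) with (Cmod (x k)) by (field; lra). nra. }
  exists (- CT t (fun k => x k / (v - t k))%C v)%C.
  set (S := Series (fun k => Cmod (x k) / Cmod (t k))).
  assert (HS : 0 <= 2 / (d * d * d) * S).
  { apply Rmult_le_pos.
    - apply Rdiv_le_0_compat; [lra|]. repeat apply Rmult_lt_0_compat; lra.
    - eapply Rle_trans; [apply (Cmod_ge_0 (RtoC 0))|].
      apply (series_bound (fun _ => RtoC 0)); [| |exact H0].
      + unfold is_series. apply (filterlim_ext (fun _ => RtoC 0)); [|apply filterlim_const].
        intro n. symmetry. apply (@sum_n_m_const_zero C_AbelianMonoid).
      + intro k. rewrite Cmod_0. assert (E := pt_ge2 k). assert (P := Cmod_ge_0 (x k)).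
        apply Rdiv_le_0_compat; lra. }
  apply (Cderiv_quadratic _ _ _ (2 / (d * d * d) * S) d); [lra|exact HS|].
  intros y Hyd.
  assert (E1 := CT_series x y H). assert (E2 := Cseries_scal (-(1))%C _ _ (CT_series x v H)).
  assert (E3 := Cseries_scal (y - v)%C _ _ (CT_series _ v Hy)).
  assert (E := Cseries_plus _ _ _ _ (Cseries_plus _ _ _ _ E1 E2) E3). clear E1 E2 E3.
  replace (2 / (d * d * d) * S * Cmod (y - v) ^ 2)
    with (Series (fun k => 2 / (d * d * d) * Cmod (y - v) ^ 2 * (Cmod (x k) / Cmod (t k))))
    by (rewrite Series_scal_l; fold S; ring).
  eapply Rle_trans; [|apply (series_bound _ _ _ E)].
  - right. f_equal. ring.
  - intro k. assert (T2 := pt_ge2 k). assert (P := Cmod_ge_0 (x k)).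
    destruct (classic (t k = v)) as [Ek|Ek].
    + rewrite (Hv k Ek). unfold Cdiv.
      match goal with |- Cmod ?e <= _ => replace e with (RtoC 0) by ring end.
      rewrite Cmod_0. unfold Rdiv. rewrite Rmult_0_l. lra.
    + specialize (Hsep k Ek).
      assert (Hyt : d * Cmod (t k) / 2 <= Cmod (y - t k)).
      { replace (y - t k)%C with ((v - t k) - (v - y))%C by ring.
        eapply Rle_trans; [|apply Cmod_sub_ge]. rewrite (Cmod_sub_sym v y). nra. }
      assert (N1 : (v - t k)%C <> RtoC 0) by (apply Csub_neq_0; congruence).
      assert (N2 : (y - t k)%C <> RtoC 0) by (apply Cmod_gt_0; nra).
      replace (x k / (y - t k) + - (1) * (x k / (v - t k)) + (y - v) * (x k / (v - t k) / (v - t k)))%C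
        with ((y - v) * (y - v) * x k / ((v - t k) * (v - t k) * (y - t k)))%C
        by (field; split; assumption).
      rewrite Cmod_div, !Cmod_mult by (repeat apply Cmult_neq_0; assumption).
      set (h := Cmod (y - v)). assert (Hh : 0 <= h) by apply Cmod_ge_0.
      set (T := Cmod (t k)) in *. set (a := Cmod (v - t k)) in *. set (b := Cmod (y - t k)) in *.
      assert (Hden : d * d * d * T / 2 <= a * a * b).
      { assert (0 < d * T) by nra.
        assert (d * T * (d * T) <= a * a) by (apply Rmult_le_compat; lra).
        assert (d <= a) by nra. assert (d * d <= a * a) by (apply Rmult_le_compat; lra).
        replace (d * d * d * T / 2) with (d * d * (d * T / 2)) by field.
        apply Rmult_le_compat; nra. }
      assert (0 < d * d * d) by (repeat apply Rmult_lt_0_compat; lra).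
      replace (2 / (d * d * d) * h ^ 2 * (Cmod (x k) / T))
        with (h * h * Cmod (x k) * / (d * d * d * T / 2)) by (field; lra).
      unfold Rdiv at 1. apply Rmult_le_compat_l; [apply Rmult_le_pos; nra|].
      apply Rinv_le_contravar; [nra|exact Hden].
  - apply (ex_series_scal (2 / (d * d * d) * Cmod (y - v) ^ 2) _ H0).
Qed.

Lemma lprod_bound (ys : list C) :
  exists B, 0 <= B /\ forall k, Cmod (lprod ys (t k)) <= B * Cmod (t k) ^ length ys.
Proof.
  induction ys as [|y ys [B [HB IH]]].
  - exists 1. split; [lra|]. intro k. simpl. rewrite Cmod_1. lra.
  - exists ((1 + Cmod y) * B). assert (P := Cmod_ge_0 y). split; [nra|].
    intro k. simpl. rewrite Cmod_mult. assert (T2 := pt_ge2 k).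
    replace ((1 + Cmod y) * B * (Cmod (t k) * Cmod (t k) ^ length ys))
      with ((1 + Cmod y) * Cmod (t k) * (B * Cmod (t k) ^ length ys)) by ring.
    apply Rmult_le_compat; try apply Cmod_ge_0; [|apply IH].
    eapply Rle_trans; [apply Cmod_sub_le|]. nra.
Qed.

Lemma moment_asum (p : nat) (q : nat -> C) (ys : list C) :
  (length ys < p)%nat -> wsum t p q -> asum (fun k => q k * lprod ys (t k))%C.
Proof.
  intros Hp H. destruct (lprod_bound ys) as [B [HB Hl]].
  apply (asum_dom _ (fun k => B * (Cmod (q k) * Cmod (t k) ^ p / Cmod (t k)))).
  2: exact (ex_series_scal B _ H).
  intro k. rewrite Cmod_mult. assert (T2 := pt_ge2 k). assert (P := Cmod_ge_0 (q k)).
  destruct p as [|p]; [lia|].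
  replace (B * (Cmod (q k) * Cmod (t k) ^ S p / Cmod (t k)))
    with (Cmod (q k) * (B * Cmod (t k) ^ p)) by (simpl; field; lra).
  apply Rmult_le_compat_l; [exact P|]. eapply Rle_trans; [apply Hl|].
  apply Rmult_le_compat_l; [exact HB|]. apply Rle_pow; [lra|lia].
Qed.

Lemma Quot_nil (x : nat -> C) : wsum t 0 x -> Quot t x nil x.
Proof.
  intro H. split; [|split; [exact H|split]].
  - intro k. simpl. ring.
  - intros ys Hys. simpl in Hys. lia.
  - intros z _. simpl. ring.
Qed.

(* [A * CT t q] vanishes at [v]: its value at [t m] is a nonzero multiple of [q m]. *)
Definition vanish (q : nat -> C) (v : C) : Prop :=
  (forall m, t m = v -> q m = RtoC 0) /\ (off t v -> CT t q v = RtoC 0).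

(** Away from the poles, [CT t q v = 0] says precisely that the quotients [q_k / (t_k - v)] sum to
    0. If [v = t m], then [q m = 0] and the quotient at [m] is undetermined; this freedom is used to
    make the sum vanish. *)
Lemma divide_weights (p : nat) (q : nat -> C) (v : C) :
  wsum t p q -> vanish q v ->
  exists q', (forall k, q k = ((t k - v) * q' k)%C) /\ wsum t (S p) q' /\
    Cseries q' (RtoC 0).
Proof.
  intros H [Hv1 Hv2].
  set (q0 := fun k => (q k / (t k - v))%C).
  assert (H0 : forall k, Cmod (q0 k) = Cmod (q k / (v - t k))).
  { intro k. unfold q0, Cdiv. rewrite !Cmod_mult, !Cmod_Cinv. now rewrite Cmod_sub_sym. }
  destruct (CT_term_bound v) as [K [HK HB]].
  assert (W0 : wsum t (S p) q0).
  { unfold wsum. apply ex_series_dom with (K := K) (2 := H).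
    intro k. assert (T2 := pt_ge2 k). assert (P := Cmod_ge_0 (q0 k)).
    assert (Q1 : 0 < Cmod (t k) ^ p) by (apply pow_lt; lra).
    replace (Cmod (q0 k) * Cmod (t k) ^ S p / Cmod (t k))
      with (Cmod (q0 k) * Cmod (t k) ^ p) by (simpl; field; lra).
    split; [nra|]. rewrite H0.
    replace (K * (Cmod (q k) * Cmod (t k) ^ p / Cmod (t k)))
      with (K * (Cmod (q k) / Cmod (t k)) * Cmod (t k) ^ p) by (field; lra).
    apply Rmult_le_compat_r; [lra|apply HB]. }
  assert (Hq0 : forall k, q k = ((t k - v) * q0 k)%C).
  { intro k. unfold q0. destruct (classic (t k = v)) as [E|N].
    - rewrite (Hv1 k E), E. unfold Cdiv. ring.
    - field. now apply Csub_neq_0. }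
  assert (S0 : Cseries q0 (csum q0)).
  { apply csum_correct. destruct (moment_asum (S p) q0 nil) as [l Hl]; [simpl; lia|exact W0|].
    exists l. revert Hl. apply is_series_ext. intro k. simpl. f_equal. ring. }
  destruct (off_or v) as [Hoff|[m Hm]].
  - exists q0. split; [exact Hq0|]. split; [exact W0|].
    assert (Wq : wsum t 0 q) by (apply (wsum_dom 0 p q q 1); [lia|lra|intro; lra|exact H]).
    assert (E := Cseries_scal (-(1))%C _ _ (CT_series q v Wq)).
    rewrite (Hv2 Hoff) in E. replace (- (1) * RtoC 0)%C with (RtoC 0) in E by ring.
    revert E. apply Cseries_ext. intro k. unfold q0.
    assert ((v - t k)%C <> RtoC 0) by (apply Csub_neq_0, Hoff).
    assert ((t k - v)%C <> RtoC 0) by (apply Csub_neq_0; intro; now apply (Hoff k)).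
    field. split; assumption.
  - set (c := csum q0) in *.
    (* The factor [t m - v] is 0, so changing the weight at [m] by [- c] does not affect the
       factorization of [q], while it cancels the sum [c]. *)
    exists (fun k => q0 k + (if Nat.eqb k m then - c else RtoC 0))%C. split; [|split].
    + intro k. destruct (Nat.eqb_spec k m) as [->|N].
      * rewrite <- Hm, (Hv1 m (eq_sym Hm)). ring.
      * rewrite Hq0. ring.
    + unfold wsum.
      assert (X := @is_series_single R_AbsRing R_NormedModule m (Cmod c * Cmod (t m) ^ S p / Cmod (t m))).
      assert (Y := ex_series_plus _ _ W0 (ex_intro _ _ X)).
      apply ex_series_dom with (K := 1) (2 := Y). intro k.
      assert (T2 := pt_ge2 k).
      assert (0 <= Cmod (t k) ^ S p / Cmod (t k)).
      { apply Rdiv_le_0_compat; [apply pow_le|]; lra. }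
      unfold Rdiv in *. split.
      * rewrite Rmult_assoc. apply Rmult_le_pos; [apply Cmod_ge_0|assumption].
      * rewrite Rmult_1_l. change (@plus R_NormedModule) with Rplus.
        change (@zero R_NormedModule) with 0.
        destruct (Nat.eqb_spec k m) as [->|N].
        -- rewrite !Rmult_assoc, <- Rmult_plus_distr_r. apply Rmult_le_compat_r; [assumption|].
           rewrite <- (Cmod_opp c). apply Cmod_triangle.
        -- right. replace (q0 k + RtoC 0)%C with (q0 k) by ring. ring.
    + assert (X := Cseries_plus _ _ _ _ S0 (@is_series_single C_AbsRing C_NormedModule m (- c)%C)).
      replace (c + - c)%C with (RtoC 0) in X by ring. exact X.
Qed.

(** Moments: [q'_k (t_k - y) = q_k + (v - y) q'_k] lowers the degree by one, down to the sum of
    [q'], which is 0. Transforms: [(t_k - v) / (z - t_k) = (z - v) / (z - t_k) - 1], and the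
    constant is killed by the same vanishing sum. *)
Lemma Quot_cons (x q : nat -> C) (zs : list C) (v : C) :
  Quot t x zs q -> vanish q v -> exists q', Quot t x (v :: zs) q'.
Proof.
  intros (H1 & H2 & H3 & H4) Hv.
  destruct (divide_weights _ q v H2 Hv) as [q' (D1 & D2 & D3)].
  exists q'. split; [|split; [exact D2|split]].
  - intro k. rewrite H1, D1. simpl. ring.
  - intro ys. simpl. induction ys as [|y ys IH]; simpl; intro Hys.
    + revert D3. apply Cseries_ext. intro k. ring.
    + assert (E1 := H3 ys ltac:(lia)). assert (E2 := Cseries_scal (v - y)%C _ _ (IH ltac:(lia))).
      assert (E := Cseries_plus _ _ _ _ E1 E2).
      replace (RtoC 0 + (v - y) * RtoC 0)%C with (RtoC 0) in E by ring.
      revert E. apply Cseries_ext. intro k. rewrite D1. ring.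
  - intros z Hz. rewrite (H4 z Hz). simpl.
    assert (W : wsum t 0 q') by (apply (wsum_dom 0 (S (length zs)) q' q' 1); [lia|lra|intro; lra|exact D2]).
    assert (CT t q z = (z - v) * CT t q' z)%C as ->; [|ring].
    apply csum_unique.
    assert (E := Cseries_plus _ _ _ _ (Cseries_scal (z - v)%C _ _ (CT_series q' z W))
                   (Cseries_scal (-(1))%C _ _ D3)).
    replace ((z - v) * CT t q' z + - (1) * RtoC 0)%C with ((z - v) * CT t q' z)%C in E by ring.
    revert E. apply Cseries_ext. intro k. rewrite D1.
    field. apply Csub_neq_0, Hz.
Qed.

End Transform.

(** * Zeros of Cauchy transforms times the generating function *)

Definition gen (t : nat -> C) (A : C -> C) : Prop :=
  entire A /\ (forall z, off t z -> A z <> RtoC 0) /\ (forall n, A (t n) = RtoC 0) /\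
  (forall n l, Cderiv A (t n) l -> l <> RtoC 0).

(** Here [x_k] stands for [a_k mu_k^(1/2)]. Only the summability needed for convergence is kept;
    square summability of the coefficients is recovered at the end because the multipliers are
    bounded. *)
Definition transform (t : nat -> C) (A : C -> C) (x : nat -> C) (f : C -> C) : Prop :=
  entire f /\ wsum t 0 x /\ forall z, off t z -> f z = (A z * CT t x z)%C.

Lemma lprod_eq_0 (ys : list C) (z : C) : lprod ys z = RtoC 0 <-> In z ys.
Proof.
  induction ys as [|y ys IH]; simpl.
  - split; [|tauto]. intro H. apply (f_equal fst) in H. simpl in H. lra.
  - split.
    + intro H. apply Cmult_integral in H. destruct H as [H|H].
      * left. symmetry. now apply Csub_eq_0.
      * right. now apply IH.
    + intros [->|H]; [ring|]. apply IH in H. rewrite H. ring.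
Qed.

Lemma lprod_deriv (ys : list C) (v : C) : exists l, Cderiv (lprod ys) v l.
Proof.
  induction ys as [|y ys [l IH]].
  - exists (RtoC 0). apply Cderiv_const.
  - eexists. apply (Cderiv_mult (fun z => z - y)%C (lprod ys)); [apply Cderiv_sub|exact IH].
Qed.

Lemma entire_deriv (f : C -> C) (v : C) : entire f -> exists l, Cderiv f v l.
Proof. intro H. exact (H v). Qed.

Lemma infinite_list {X : Type} (P : X -> Prop) : ~ finite_set P ->
  forall p, exists zs, length zs = p /\ NoDup zs /\ forall z, In z zs -> P z.
Proof.
  intros H p. induction p as [|p (zs & H1 & H2 & H3)].
  - exists nil. repeat split; [constructor|intros z []].
  - assert (exists z, P z /\ ~ In z zs) as [z [Hz Hn]].
    { apply NNPP. intro N. apply H. exists zs. intros z Hz. apply NNPP. intro N'.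
      apply N. now exists z. }
    exists (z :: zs). split; [simpl; congruence|]. split; [now constructor|].
    intros z' [<-|Hz']; auto.
Qed.

Section Zeros.
Context (t : nat -> C) (Ht : point_seq t) (A : C -> C) (HA : gen t A).

Lemma near_off (v : C) :
  exists d, 0 < d /\ forall y, Cmod (y - v) < d -> y = v \/ off t y.
Proof.
  destruct (sep_point t Ht v) as [d [Hd H]]. exists d. split; [lra|].
  intros y Hy. destruct (off_or t y) as [Ho|[m Hm]]; [now right|left].
  apply NNPP. intro N. rewrite Hm in N, Hy. specialize (H m N).
  rewrite Cmod_sub_sym in H. assert (E := pt_ge2 t Ht m). nra.
Qed.

(** Near [t m] the functions [(z - t m) f(z)] and [A(z) (x_m + (z - t m) CT t (zap m x) z)] agree,
    the point [t m] included; comparing their derivatives at [t m], where [A] vanishes, gives the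
    value. *)
Lemma value_at_pole (x : nat -> C) (f : C -> C) (m : nat) (l : C) :
  transform t A x f -> Cderiv A (t m) l -> f (t m) = (l * x m)%C.
Proof.
  intros (Hf & Hx & Hfx) Hl.
  destruct (near_off (t m)) as [d [Hd Hn]].
  destruct (entire_deriv f (t m) Hf) as [f' Hf'].
  destruct (CT_deriv t Ht (zap m x) (t m) (wsum_zap t Ht 0 m x Hx)) as [c Hc].
  { intros k Hk. apply (pt_inj t Ht) in Hk. subst k. apply zap_same. }
  assert (D1 := Cderiv_mult _ _ _ _ _ (Cderiv_sub (t m) (t m)) Hf').
  assert (D2 := Cderiv_mult _ _ _ _ _ Hl (Cderiv_plus _ _ _ _ _ (Cderiv_const (x m) (t m))
     (Cderiv_mult _ _ _ _ _ (Cderiv_sub (t m) (t m)) Hc))).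
  simpl in D1, D2.
  assert (D3 : Cderiv (fun z => (z - t m) * f z)%C (t m)
    (l * (x m + (t m - t m) * CT t (zap m x) (t m)) +
     A (t m) * (RtoC 0 + (RtoC 1 * CT t (zap m x) (t m) + (t m - t m) * c)))%C).
  { revert D2. apply (Cderiv_ext_loc _ _ _ _ d Hd). intros y Hy.
    destruct (Hn y Hy) as [->|Ho].
    - destruct HA as (_ & _ & H0 & _). rewrite H0. ring.
    - rewrite (Hfx y Ho), (CT_zap t Ht m x y Hx). field. apply Csub_neq_0, Ho. }
  assert (E := Cderiv_unique _ _ _ _ D1 D3).
  destruct HA as (_ & _ & H0 & _). rewrite H0 in E.
  replace (f (t m)) with (RtoC 1 * f (t m) + (t m - t m) * f')%C by ring.
  rewrite E. ring.
Qed.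

Lemma A_deriv (m : nat) : exists l, Cderiv A (t m) l /\ l <> RtoC 0.
Proof.
  destruct HA as (H1 & _ & _ & H3). destruct (entire_deriv A (t m) H1) as [l Hl].
  exists l. split; [exact Hl|]. exact (H3 m l Hl).
Qed.

Lemma vanish_simple (x q : nat -> C) (f : C -> C) (zs : list C) (v : C) :
  transform t A x f -> Quot t x zs q -> f v = RtoC 0 -> lprod zs v <> RtoC 0 ->
  vanish t q v.
Proof.
  intros Hf (Q1 & Q2 & Q3 & Q4) Hv Hl. split.
  - intros m Hm. destruct (A_deriv m) as [l [Hl1 Hl2]].
    assert (E := value_at_pole x f m l Hf Hl1). rewrite Hm, Hv, Q1, Hm in E.
    symmetry in E. apply Cmult_integral in E. destruct E as [E|E]; [contradiction|].
    apply Cmult_integral in E. tauto.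
  - intro Ho. destruct Hf as (_ & _ & Hf). rewrite (Hf v Ho), (Q4 v Ho) in Hv.
    destruct HA as (_ & H0 & _).
    apply Cmult_integral in Hv. destruct Hv as [E|E]; [now elim (H0 v Ho)|].
    apply Cmult_integral in E. tauto.
Qed.

(** Away from the poles, [f = A * (z - v) * lprod zs * CT t q] near [v], so that [f'(v)] is a
    nonzero multiple of [CT t q v]. At [v = t m] the factor [z - v] cancels the pole of the [m]-th
    term, and [f'(v)] becomes a nonzero multiple of [q m]. *)
Lemma vanish_double (x q : nat -> C) (f : C -> C) (zs : list C) (v : C) :
  transform t A x f -> Quot t x (v :: zs) q -> Cderiv f v (RtoC 0) ->
  lprod zs v <> RtoC 0 -> vanish t q v.
Proof.
  intros Hf (Q1 & Q2 & Q3 & Q4) Hv Hl.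
  assert (Wq : wsum t 0 q).
  { apply (wsum_dom t Ht 0 (length (v :: zs)) q q 1); [lia|lra|intro; lra|exact Q2]. }
  destruct (lprod_deriv zs v) as [l' Hl'].
  destruct (near_off v) as [d [Hd Hn]].
  assert (HA' := HA). destruct HA' as (A1 & A2 & A3 & A4).
  split.
  - intros m Hm. destruct (A_deriv m) as [l [Hl1 Hl2]]. rewrite Hm in Hl1.
    destruct (CT_deriv t Ht (zap m q) v (wsum_zap t Ht 0 m q Wq)) as [c Hc].
    { intros k Hk. rewrite <- Hm in Hk. apply (pt_inj t Ht) in Hk. subst k. apply zap_same. }
    assert (D := Cderiv_mult _ _ _ _ _ Hl1 (Cderiv_mult _ _ _ _ _ Hl'
      (Cderiv_plus _ _ _ _ _ (Cderiv_const (q m) v)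
       (Cderiv_mult _ _ _ _ _ (Cderiv_sub v v) Hc)))).
    simpl in D.
    apply (Cderiv_ext_loc _ f v _ d Hd) in D.
    + assert (E := Cderiv_unique _ _ _ _ Hv D).
      assert (E' : (l * (lprod zs v * q m))%C = RtoC 0).
      { rewrite E. assert (A v = RtoC 0) as -> by (rewrite <- Hm; apply A3). ring. }
      apply Cmult_integral in E'. destruct E' as [E'|E']; [contradiction|].
      apply Cmult_integral in E'. tauto.
    + intros y Hy. destruct (Hn y Hy) as [->|Ho].
      * assert (f v = RtoC 0) as ->.
        { rewrite <- Hm in Hl1 |- *. rewrite (value_at_pole x f m l Hf Hl1), Q1, Hm. simpl. ring. }
        assert (A v = RtoC 0) as -> by (rewrite <- Hm; apply A3). simpl. ring.
      * destruct Hf as (_ & _ & Hf). rewrite (Hf y Ho), (Q4 y Ho), (CT_zap t Ht m q y Wq), Hm.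
        simpl. field. rewrite <- Hm. apply Csub_neq_0, Ho.
  - intro Ho. destruct (entire_deriv A v A1) as [l Hl1].
    destruct (CT_deriv t Ht q v Wq) as [c Hc].
    { intros k Hk. now elim (Ho k). }
    assert (D := Cderiv_mult _ _ _ _ _ (Cderiv_sub v v)
       (Cderiv_mult _ _ _ _ _ Hl1 (Cderiv_mult _ _ _ _ _ Hl' Hc))).
    simpl in D. apply (Cderiv_ext_loc _ f v _ d Hd) in D.
    + assert (E := Cderiv_unique _ _ _ _ Hv D).
      assert (E' : (A v * (lprod zs v * CT t q v))%C = RtoC 0) by (rewrite E; ring).
      apply Cmult_integral in E'. destruct E' as [E'|E']; [now elim (A2 v Ho)|].
      apply Cmult_integral in E'. tauto.
    + intros y Hy. assert (Hoy : off t y) by (destruct (Hn y Hy) as [->|]; assumption).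
      destruct Hf as (_ & _ & Hf). rewrite (Hf y Hoy), (Q4 y Hoy). simpl. ring.
Qed.

Lemma Quot_list (x : nat -> C) (f : C -> C) (zs : list C) :
  transform t A x f -> NoDup zs -> (forall z, In z zs -> f z = RtoC 0) ->
  exists q, Quot t x zs q.
Proof.
  intros Hf Hnd. induction Hnd as [|z zs Hz Hnd IH]; intro H.
  - exists x. apply Quot_nil, Hf.
  - destruct IH as [q Hq]; [intros z' Hz'; apply H; now right|].
    apply (Quot_cons t Ht x q zs z Hq).
    apply (vanish_simple x q f zs z Hf Hq); [apply H; now left|].
    now rewrite lprod_eq_0.
Qed.

(** Factor by factor: [|t m - z| <= |t m| + R], and [|t k - z| >= |t k| / 2] because
    [|t k| >= 2R]. *)
Lemma lprod_ratio (zs : list C) (R : R) (m k : nat) :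
  (forall z, In z zs -> Cmod z <= R) -> 0 <= R -> 2 * R <= Cmod (t k) ->
  Cmod (lprod zs (t m)) * Cmod (t k) ^ length zs <=
  (2 * (Cmod (t m) + R)) ^ length zs * Cmod (lprod zs (t k)).
Proof.
  intros HR HR0 Hk. assert (Tk := pt_ge2 t Ht k). assert (Tm := pt_ge2 t Ht m).
  induction zs as [|z zs IH]; [simpl; rewrite Cmod_1; lra|].
  simpl. rewrite !Cmod_mult.
  specialize (IH (fun z' Hz' => HR z' (or_intror Hz'))).
  assert (Hz := HR z (or_introl eq_refl)).
  set (D := 2 * (Cmod (t m) + R)) in *. set (T := Cmod (t k)) in *.
  assert (B1 : Cmod (t m - z) * T <= D * Cmod (t k - z)).
  { assert (E1 := Cmod_sub_le (t m) z). assert (E2 := Cmod_sub_ge (t k) z). fold T in E2.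
    apply Rle_trans with (D / 2 * T).
    - apply Rmult_le_compat_r; unfold D; lra.
    - assert (0 < D) by (unfold D; lra). nra. }
  replace (Cmod (t m - z) * Cmod (lprod zs (t m)) * (T * T ^ length zs))
    with ((Cmod (t m - z) * T) * (Cmod (lprod zs (t m)) * T ^ length zs)) by ring.
  replace (D * D ^ length zs * (Cmod (t k - z) * Cmod (lprod zs (t k))))
    with ((D * Cmod (t k - z)) * (D ^ length zs * Cmod (lprod zs (t k)))) by ring.
  assert (P1 := Cmod_ge_0 (t m - z)). assert (P2 := Cmod_ge_0 (lprod zs (t m))).
  assert (0 <= T ^ length zs) by (apply pow_le; lra).
  apply Rmult_le_compat; try assumption; apply Rmult_le_pos; lra.
Qed.

(* The moment of [q] against [P = prod (z - t j)] over the [j <> m] with [t j]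
   small leaves [q m] and indices [k] with [t k] far from all the zeros; scaled by
   [lprod zs (t m)] the latter contribute a geometrically small amount as the
   number of zeros grows. *)
Lemma many_zeros_weight_0 (x : nat -> C) (R : R) :
  wsum t 0 x ->
  (forall p, exists zs q, length zs = p /\ (forall z, In z zs -> Cmod z <= R) /\ Quot t x zs q) ->
  forall m, x m = RtoC 0.
Proof.
  intros Hx H m.
  assert (HR : 0 <= R).
  { destruct (H 1%nat) as (zs & q & Hl & HzR & _). destruct zs as [|z zs]; [discriminate|].
    eapply Rle_trans; [apply (Cmod_ge_0 z)|apply HzR; now left]. }
  set (D := 2 * (Cmod (t m) + R)). assert (Tm := pt_ge2 t Ht m).
  assert (HD : 4 <= D) by (unfold D; lra).
  (* Beyond [L] the ratio [D / |t k|] is below 1/2, which is the source of the geometric factor. *)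
  destruct (pt_inf t Ht (2 * D)) as [L HL].
  set (ys := map t (remove Nat.eq_dec m (seq 0 L))).
  assert (Y1 : lprod ys (t m) <> RtoC 0).
  { rewrite lprod_eq_0. unfold ys. rewrite in_map_iff. intros [j [E Hj]].
    apply (pt_inj t Ht) in E. subst j. now apply remove_In in Hj. }
  assert (Y2 : forall k, (k < L)%nat -> k <> m -> lprod ys (t k) = RtoC 0).
  { intros k Hk N. apply lprod_eq_0. unfold ys. apply in_map. apply in_in_remove; [exact N|].
    apply in_seq. lia. }
  destruct (lprod_bound t Ht ys) as [B [HB HlB]].
  set (Q := length ys) in *.
  set (S := Series (fun k => Cmod (x k) / Cmod (t k))).
  assert (HS := proj1 (wsum_0 t x) Hx).
  assert (Key : forall r, Cmod (x m * lprod ys (t m)) <= B * D ^ (Q + 1) * S * (1 / 2) ^ r).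
  (* Of the [Q + 1 + r] powers of [1 / |t k|] gained from the zeros, [Q] absorb the growth of
     [lprod ys], one turns [|x k|] into the summable [|x k| / |t k|], and [r] produce
     [(1 / 2) ^ r]. *)
  { intro r. destruct (H (Q + 1 + r)%nat) as (zs & q & Hlen & HzR & Q1 & Q2 & Q3 & _).
    assert (E := Cseries_scal (lprod zs (t m)) _ _ (Q3 ys ltac:(fold Q; lia))).
    (* Subtracting the term at [m] from the vanishing moment leaves a series with sum
       [- (x m * lprod ys (t m))], whose terms with index below [L] are all 0. *)
    assert (E2 := Cseries_plus _ _ _ _ E (@is_series_single C_AbsRing C_NormedModule m
      (- (x m * lprod ys (t m)))%C)).
    replace (lprod zs (t m) * RtoC 0 + - (x m * lprod ys (t m)))%C
      with (- (x m * lprod ys (t m)))%C in E2 by ring.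
    rewrite <- Cmod_opp.
    replace (B * D ^ (Q + 1) * S * (1 / 2) ^ r) with
      (Series (fun k => B * D ^ (Q + 1) * (1 / 2) ^ r * (Cmod (x k) / Cmod (t k))))
      by (rewrite Series_scal_l; unfold S; ring).
    apply (series_bound _ _ _ E2).
    2: exact (ex_series_scal (B * D ^ (Q + 1) * (1 / 2) ^ r) _ HS).
    intro k. change (@zero C_NormedModule) with (RtoC 0).
    assert (Tk := pt_ge2 t Ht k). assert (Pk := Cmod_ge_0 (x k)).
    assert (PD : 0 < D ^ (Q + 1)) by (apply pow_lt; lra).
    assert (P2 : 0 < (1 / 2) ^ r) by (apply pow_lt; lra).
    assert (Pos : 0 <= B * D ^ (Q + 1) * (1 / 2) ^ r * (Cmod (x k) / Cmod (t k))).
    { assert (0 <= Cmod (x k) / Cmod (t k)) by (apply Rdiv_le_0_compat; lra).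
      apply Rmult_le_pos; [|assumption]. repeat apply Rmult_le_pos; lra. }
    destruct (Nat.eqb_spec k m) as [->|N].
    - match goal with |- Cmod ?e <= _ => replace e with (RtoC 0) by (rewrite (Q1 m); ring) end.
      rewrite Cmod_0. exact Pos.
    - destruct (Nat.lt_ge_cases k L) as [Hk|Hk].
      + rewrite (Y2 k Hk N).
        match goal with |- Cmod ?e <= _ => replace e with (RtoC 0) by ring end.
        rewrite Cmod_0. exact Pos.
      + specialize (HL k Hk).
        assert (F := lprod_ratio zs R m k HzR HR ltac:(unfold D in HL; lra)).
        fold D in F. rewrite Hlen in F.
        match goal with |- Cmod ?e <= _ =>
          replace e with (lprod zs (t m) * (q k * lprod ys (t k)))%C by ring end.
        rewrite !Cmod_mult.
        set (T := Cmod (t k)) in *. specialize (HlB k). fold T Q in HlB.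
        assert (Xk : Cmod (x k) = Cmod (lprod zs (t k)) * Cmod (q k)) by (rewrite <- Cmod_mult; now rewrite <- Q1).
        assert (PT : 0 < T ^ (Q + 1 + r)) by (apply pow_lt; lra).
        apply Rmult_le_reg_r with (T ^ (Q + 1 + r)); [exact PT|].
        apply Rle_trans with (D ^ (Q + 1 + r) * Cmod (x k) * (B * T ^ Q)).
        * rewrite Xk.
          replace (Cmod (lprod zs (t m)) * (Cmod (q k) * Cmod (lprod ys (t k))) * T ^ (Q + 1 + r))
            with ((Cmod (lprod zs (t m)) * T ^ (Q + 1 + r)) * Cmod (q k) * Cmod (lprod ys (t k))) by ring.
          rewrite <- (Rmult_assoc (D ^ (Q + 1 + r))).
          apply Rmult_le_compat; try apply Cmod_ge_0; [|apply Rmult_le_compat_r; [apply Cmod_ge_0|exact F]|exact HlB].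
          apply Rmult_le_pos; [apply Rmult_le_pos; [apply Cmod_ge_0|lra]|apply Cmod_ge_0].
        * rewrite (pow_add D), (pow_add T), (pow_add T Q 1).
          assert (G : D ^ r <= (1 / 2) ^ r * T ^ r).
          { rewrite <- Rpow_mult_distr. apply pow_incr. lra. }
          replace (B * D ^ (Q + 1) * (1 / 2) ^ r * (Cmod (x k) / T) * (T ^ Q * T ^ 1 * T ^ r))
            with (D ^ (Q + 1) * Cmod (x k) * B * T ^ Q * ((1 / 2) ^ r * T ^ r)) by (simpl; field; lra).
          replace (D ^ (Q + 1) * D ^ r * Cmod (x k) * (B * T ^ Q))
            with (D ^ (Q + 1) * Cmod (x k) * B * T ^ Q * D ^ r) by ring.
          apply Rmult_le_compat_l; [|exact G].
          assert (0 < T ^ Q) by (apply pow_lt; lra).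
          repeat apply Rmult_le_pos; lra. }
  apply NNPP. intro N.
  assert (Pos : 0 < Cmod (x m * lprod ys (t m))).
  { rewrite Cmod_mult. apply Rmult_lt_0_compat; now apply Cmod_gt_0. }
  set (c := B * D ^ (Q + 1) * S) in *.
  assert (Hc : 0 < c).
  { specialize (Key 0%nat). simpl in Key. lra. }
  destruct (pow_lt_1_zero (1 / 2) ltac:(rewrite Rabs_pos_eq; lra)
    (Cmod (x m * lprod ys (t m)) / c)) as [r Hr].
  { now apply Rdiv_lt_0_compat. }
  specialize (Hr r (Nat.le_refl r)). specialize (Key r).
  rewrite Rabs_pos_eq in Hr by (apply pow_le; lra).
  apply Rmult_lt_compat_l with (r := c) in Hr; [|exact Hc].
  replace (c * (Cmod (x m * lprod ys (t m)) / c)) with (Cmod (x m * lprod ys (t m))) in Hr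
    by (field; lra).
  lra.
Qed.

(** This plays the part of the identity theorem: infinitely many zeros in a bounded disc would force
    every weight to vanish. *)
Lemma zeros_unbounded (x : nat -> C) (f : C -> C) (P : C -> Prop) (m : nat) :
  transform t A x f -> x m <> RtoC 0 -> (forall z, P z -> f z = RtoC 0) ->
  ~ finite_set P -> forall B, exists z, P z /\ B < Cmod z.
Proof.
  intros Hf Hm HP Hinf B. apply NNPP. intro N. apply Hm.
  apply (many_zeros_weight_0 x B); [apply Hf|]. intro p.
  destruct (infinite_list P Hinf p) as (zs & Hlen & Hnd & Hz).
  destruct (Quot_list x f zs Hf Hnd) as [q Hq]; [intros; now apply HP, Hz|].
  exists zs, q. split; [exact Hlen|]. split; [|exact Hq].
  intros z Hzz. apply Rnot_lt_le. intro G. apply N. exists z. split; [now apply Hz|exact G].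
Qed.

(** The values [f (t m) = A'(t m) x_m] with [A'(t m) <> 0] detect the weights one by one. *)
Lemma transform_nonzero (x : nat -> C) (f : C -> C) :
  transform t A x f -> (nonzero f <-> exists m, x m <> RtoC 0).
Proof.
  intro Hf. split.
  - intros [z Hz]. apply NNPP. intro N. apply Hz.
    assert (X : forall m, x m = RtoC 0).
    { intro m. apply NNPP. intro N'. apply N. now exists m. }
    destruct (off_or t z) as [Ho|[m ->]].
    + destruct Hf as (_ & _ & Hf). rewrite (Hf z Ho).
      assert (CT t x z = RtoC 0) as ->; [|ring].
      unfold CT. rewrite (csum_ext _ (fun _ => RtoC 0)).
      * apply csum_unique. apply (Cseries_ext (fun k : nat => if Nat.eqb k 0 then RtoC 0 else RtoC 0)).
        -- intro k. now destruct (Nat.eqb k 0).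
        -- apply (@is_series_single C_AbsRing C_NormedModule 0 (RtoC 0)).
      * intro k. rewrite X. unfold Cdiv. ring.
    + destruct (A_deriv m) as [l [Hl _]]. rewrite (value_at_pole x f m l Hf Hl), X. ring.
  - intros [m Hm]. exists (t m). destruct (A_deriv m) as [l [Hl Hl0]].
    rewrite (value_at_pole x f m l Hf Hl). now apply Cmult_neq_0.
Qed.

(* Near [t m], [A] times the [m]-th term of [CT t x] is [f - A * CT t (zap m x)],
   so its removable singularity is inherited from [f]. *)
Lemma multiplier (x beta : nat -> C) (f : C -> C) (K : R) :
  transform t A x f -> 0 <= K -> (forall k, Cmod (beta k) <= K) ->
  exists g, transform t A (fun k => x k * beta k)%C g /\
    (forall m, g (t m) = (beta m * f (t m))%C) /\
    (forall m l, beta m = RtoC 0 -> Cderiv A (t m) l ->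
       Cderiv g (t m) (l * CT t (fun k => x k * beta k)%C (t m))%C).
Proof.
  intros Hf HK Hbeta. set (b := fun k => (x k * beta k)%C).
  assert (Wb : wsum t 0 b).
  { apply (wsum_dom t Ht 0 0 b x K); [lia|exact HK| |apply Hf].
    intro k. unfold b. rewrite Cmod_mult, Rmult_comm.
    apply Rmult_le_compat_r; [apply Cmod_ge_0|apply Hbeta]. }
  assert (Wx : wsum t 0 x) by apply Hf.
  (* The prescribed value at [t m] is forced: it equals [A'(t m)] times the new weight
     [x m * beta m]. *)
  assert (Hg : forall z, exists w : C, (off t z -> w = (A z * CT t b z)%C) /\
             forall m, z = t m -> w = (beta m * f (t m))%C).
  { intro z. destruct (off_or t z) as [Ho|[m Hm]].
    - exists (A z * CT t b z)%C. split; [reflexivity|]. intros m Hm. now elim (Ho m).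
    - exists (beta m * f (t m))%C. split; [intro Ho; now elim (Ho m)|].
      intros m' Hm'. rewrite Hm in Hm'. apply (pt_inj t Ht) in Hm'. now subst. }
  set (g := fun z => proj1_sig (constructive_indefinite_description _ (Hg z))).
  assert (G1 : forall z, off t z -> g z = (A z * CT t b z)%C).
  { intro z. unfold g. destruct (constructive_indefinite_description _ (Hg z)). simpl. apply a. }
  assert (G2 : forall m, g (t m) = (beta m * f (t m))%C).
  { intro m. unfold g. destruct (constructive_indefinite_description _ (Hg (t m))). simpl.
    now apply a. }
  clearbody g.
  assert (HA' := HA). destruct HA' as (A1 & A2 & A3 & A4).
  assert (Dz : forall y m, wsum t 0 y -> exists c, Cderiv (CT t (zap m y)) (t m) c).
  { intros y m Wy. apply (CT_deriv t Ht); [now apply wsum_zap|].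
    intros k Hk. apply (pt_inj t Ht) in Hk. subst k. apply zap_same. }
  exists g. split; [split; [|split; assumption]|split; [exact G2|]].
  - intro v. destruct (near_off v) as [d [Hd Hn]].
    destruct (off_or t v) as [Ho|[m ->]].
    + destruct (entire_deriv A v A1) as [l Hl].
      destruct (CT_deriv t Ht b v Wb) as [c Hc]; [intros k Hk; now elim (Ho k)|].
      eexists. apply (Cderiv_ext_loc (fun z => A z * CT t b z)%C g v _ d Hd).
      * intros y Hy. symmetry. apply G1. destruct (Hn y Hy) as [->|]; assumption.
      * apply (Cderiv_mult _ _ _ _ _ Hl Hc).
    + destruct (entire_deriv A (t m) A1) as [l Hl].
      destruct (entire_deriv f (t m) (proj1 Hf)) as [l' Hl'].
      destruct (Dz b m Wb) as [cb Hcb]. destruct (Dz x m Wx) as [cx Hcx].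
      eexists. apply (Cderiv_ext_loc (fun z => beta m * (f z + (-(1)) * (A z * CT t (zap m x) z))
                         + A z * CT t (zap m b) z)%C g (t m) _ d Hd).
      * intros y Hy. destruct (Hn y Hy) as [->|Hoy].
        -- rewrite G2, A3. ring.
        -- rewrite (G1 y Hoy). destruct Hf as (_ & _ & Hf). rewrite (Hf y Hoy).
           rewrite (CT_zap t Ht m x y Wx), (CT_zap t Ht m b y Wb).
           unfold b at 2. field. apply Csub_neq_0, Hoy.
      * apply Cderiv_plus; [|apply (Cderiv_mult _ _ _ _ _ Hl Hcb)].
        apply Cderiv_scal. apply Cderiv_plus; [exact Hl'|].
        apply Cderiv_scal. apply (Cderiv_mult _ _ _ _ _ Hl Hcx).
  - intros m l Hm Hl. destruct (near_off (t m)) as [d [Hd Hn]].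
    (* As [beta m = 0], the term at [t m] is absent, so [g = A * CT t b] holds at [t m] as well;
       since [A (t m) = 0], only the derivative of [A] contributes. *)
    assert (Eb : zap m b = b).
    { apply functional_extensionality. intro k. unfold zap.
      destruct (Nat.eqb_spec k m) as [->|]; [|reflexivity]. unfold b. rewrite Hm. ring. }
    destruct (Dz b m Wb) as [c Hc]. rewrite Eb in Hc.
    assert (D := Cderiv_mult _ _ _ _ _ Hl Hc). rewrite A3 in D.
    replace (l * CT t b (t m) + RtoC 0 * c)%C with (l * CT t b (t m))%C in D by ring.
    apply (Cderiv_ext_loc (fun z => A z * CT t b z)%C g (t m) _ d Hd); [|exact D].
    intros y Hy. destruct (Hn y Hy) as [->|Hoy].
    + rewrite G2, A3, Hm. ring.
    + symmetry. now apply G1.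
Qed.

End Zeros.

(** * Moving pairs of zeros *)

(** Dependent choice with memory: each new pair has to be chosen far out relative to all the earlier
    ones, hence the list as state. *)
Lemma list_choice {X : Type} (P : list X -> Prop) (R : list X -> X -> Prop) :
  P nil -> (forall l, P l -> exists x, R l x /\ P (x :: l)) ->
  exists (u : nat -> X) (l : nat -> list X), l 0%nat = nil /\
    forall n, l (S n) = u n :: l n /\ R (l n) (u n) /\ P (l n).
Proof.
  intros H0 H.
  set (next := fun s : {l | P l} =>
    constructive_indefinite_description _ (H (proj1_sig s) (proj2_sig s))).
  set (st := fix st n : {l | P l} := match n with
    | O => exist _ nil H0
    | S n => exist _ (proj1_sig (next (st n)) :: proj1_sig (st n)) (proj2 (proj2_sig (next (st n))))
    end).
  exists (fun n => proj1_sig (next (st n))), (fun n => proj1_sig (st n)).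
  split; [reflexivity|]. intro n. split; [reflexivity|]. split.
  - exact (proj1 (proj2_sig (next (st n)))).
  - exact (proj2_sig (st n)).
Qed.

Lemma half_pow_small (c e : R) : 0 < e -> exists J, c * (1 / 2) ^ J < e.
Proof.
  intro He. destruct (Rle_or_lt c 0) as [Hc|Hc].
  - exists 0%nat. simpl. lra.
  - destruct (pow_lt_1_zero (1 / 2) ltac:(rewrite Rabs_pos_eq; lra) (e / c)) as [J HJ].
    { now apply Rdiv_lt_0_compat. }
    exists J. specialize (HJ J (Nat.le_refl J)).
    rewrite Rabs_pos_eq in HJ by (apply pow_le; lra).
    apply Rmult_lt_compat_l with (r := c) in HJ; [|exact Hc].
    replace (c * (e / c)) with e in HJ by (field; lra). exact HJ.
Qed.

Lemma half_pow_le_0 (y c : R) : (forall J, y <= c * (1 / 2) ^ J) -> y <= 0.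
Proof.
  intro H. apply Rnot_lt_le. intro G. destruct (half_pow_small c y G) as [J HJ].
  specialize (H J). lra.
Qed.

Lemma geometric_limit (v : nat -> C) (e : R) :
  (forall j, Cmod (v (S j) - v j) <= e * (1 / 2) ^ j) ->
  exists l, forall J, Cmod (l - v J) <= 2 * e * (1 / 2) ^ J.
Proof.
  intro H.
  assert (G : ex_series (fun j => e * (1 / 2) ^ j)).
  { apply (ex_series_scal (K := R_AbsRing) (V := R_NormedModule) e (fun j => (1 / 2) ^ j)).
    apply ex_series_geom. rewrite Rabs_pos_eq; lra. }
  set (d := fun j => (v (S j) - v j)%C).
  assert (Hd : Cseries d (csum d)) by (apply csum_correct, (asum_dom d _ H G)).
  exists (v 0%nat + csum d)%C. intro J.
  assert (HJ : Cseries (fun j => d (J + j)%nat) (v 0%nat + csum d - v J)%C).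
  { destruct J as [|J].
    - replace (v 0%nat + csum d - v 0%nat)%C with (csum d) by ring. exact Hd.
    - apply (is_series_incr_n d (S J)); [lia|]. simpl Init.Nat.pred.
      assert (E : @sum_n C_AbelianMonoid d J = (v (S J) - v 0%nat)%C).
      { induction J as [|J IH].
        - rewrite sum_O. reflexivity.
        - rewrite sum_Sn, IH. change ((v (S J) - v 0%nat + (v (S (S J)) - v (S J)))%C = (v (S (S J)) - v 0%nat)%C). ring. }
      match goal with |- Cseries d ?a => replace a with (csum d); [exact Hd|] end.
      change (csum d = (v 0%nat + csum d - v (S J) + @sum_n C_AbelianMonoid d J)%C). rewrite E.
      change (csum d = (v 0%nat + csum d - v (S J) + (v (S J) - v 0%nat))%C). ring. }
  assert (GJ : is_series (fun j => e * (1 / 2) ^ (J + j)) (2 * e * (1 / 2) ^ J)).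
  { assert (X := is_series_scal (e * (1 / 2) ^ J) _ _ (is_series_geom (1 / 2) ltac:(rewrite Rabs_pos_eq; lra))).
    change (@scal R_AbsRing R_NormedModule) with Rmult in X.
    replace (2 * e * (1 / 2) ^ J) with (e * (1 / 2) ^ J * / (1 - 1 / 2)) by field.
    revert X. apply is_series_ext. intro j.
    change (e * (1 / 2) ^ J * (1 / 2) ^ j = e * (1 / 2) ^ (J + j)). rewrite pow_add. ring. }
  rewrite <- (is_series_unique _ _ GJ).
  apply (series_bound _ _ _ HJ); [intro j; apply H|]. eexists. exact GJ.
Qed.

(* The zeros [qz] and [qw] are to be moved to [t qn] and [qs]. *)
Record quad := { qz : C; qw : C; qn : nat; qs : C }.

Definition far (t : nat -> C) (B : R) (u : quad) : Prop :=
  B <= Cmod (qz u) /\ B <= Cmod (qw u) /\ B <= Cmod (t (qn u)) /\ B <= Cmod (qs u).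

Definition isolated (t : nat -> C) (c : R) (N : nat) (n : nat) (z : C) : Prop :=
  forall k, k <> n -> c <= Cmod (z - t k) * Cmod (t k) ^ N.

Definition zero_pair (f : C -> C) (z w : C) : Prop :=
  (z <> w /\ f z = RtoC 0 /\ f w = RtoC 0) \/
  (z = w /\ f z = RtoC 0 /\ Cderiv f z (RtoC 0)).

(** If [qz u] or [qw u] equals the centre [t (qn u)], the corresponding inverse there is [/ 0 = 0];
    the value at the centre is thus 0 in all cases. *)
Definition mfac (t : nat -> C) (u : quad) (s : C) : C :=
  ((1 - s / t (qn u)) * (1 - s / qs u) * / (1 - s / qz u) * / (1 - s / qw u))%C.

(** The multiplier that moves the pair to the single point [t (qn u)]. Its numerator has degree one
    less than its denominator. *)
Definition hfac (t : nat -> C) (u : quad) (s : C) : C :=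
  ((1 - s / t (qn u)) * / (1 - s / qz u) * / (1 - s / qw u))%C.

Definition mprod (t : nat -> C) (l : list quad) (s : C) : C :=
  fold_right (fun u acc => (mfac t u s * acc)%C) (RtoC 1) l.

Definition hprod (t : nat -> C) (l : list quad) (s : C) : C :=
  fold_right (fun u acc => (hfac t u s * acc)%C) (RtoC 1) l.

Definition zlist (l : list quad) : list C := flat_map (fun u => qz u :: qw u :: nil) l.
Definition ylist (t : nat -> C) (l : list quad) : list C :=
  flat_map (fun u => t (qn u) :: qs u :: nil) l.
Definition nlist (t : nat -> C) (l : list quad) : list C := map (fun u => t (qn u)) l.

(** The zeros of a new pair exceed all earlier ones in modulus, so the product over the earlier
    zeros does not vanish at them and the division can continue. *)
Fixpoint good (t : nat -> C) (V : quad -> Prop) (l : list quad) : Prop :=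
  match l with
  | nil => True
  | u :: l => V u /\ far t 1 u /\
      (forall z, In z (zlist l) -> Cmod z < Cmod (qz u) /\ Cmod z < Cmod (qw u)) /\
      good t V l
  end.

Lemma lprod_app (l1 l2 : list C) (z : C) : lprod (l1 ++ l2) z = (lprod l1 z * lprod l2 z)%C.
Proof. induction l1 as [|y l1 IH]; simpl; [|rewrite IH]; ring. Qed.

Lemma modulus_bound (l : list C) : exists B, forall z, In z l -> Cmod z < B.
Proof.
  induction l as [|y l [B IH]]; [exists 0; intros z []|].
  exists (Rmax (Cmod y + 1) B). intros z [<-|Hz].
  - eapply Rlt_le_trans; [|apply Rmax_l]. lra.
  - eapply Rlt_le_trans; [now apply IH|apply Rmax_r].
Qed.

Definition admissible (t : nat -> C) (c : R) (N : nat) (u : quad) : Prop :=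
  isolated t c N (qn u) (qz u) /\ isolated t c N (qn u) (qw u).

(** * Growth, decay and cancellation of the multipliers *)

Section Factors.
Context (t : nat -> C) (Ht : point_seq t).
Context (c : R) (N : nat) (Hc : 0 < c).

Lemma inv_modulus (z s : C) : z <> RtoC 0 ->
  Cmod (/ (1 - s / z)) = Cmod z * / Cmod (z - s).
Proof.
  intro Hz. replace (1 - s / z)%C with ((z - s) / z)%C by (field; exact Hz).
  unfold Cdiv. rewrite Cmod_Cinv, Cmod_mult, Cmod_Cinv, Rinv_mult, Rinv_inv. ring.
Qed.

(** If [|z| >= 2 |t_k|], then [|z - t_k| >= |z| / 2]. Otherwise [|z| < 2 |t_k|], and isolation
    bounds [1 / |z - t_k|] by [|t_k|^N / c]. The constant does not depend on [z]. *)
Lemma inv_bound_uniform (z : C) (n k : nat) : z <> RtoC 0 -> isolated t c N n z -> k <> n ->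
  Cmod (/ (1 - t k / z)) <= (2 + 2 / c) * Cmod (t k) ^ (N + 1).
Proof.
  intros Hz Hi Hk. specialize (Hi k Hk). rewrite (inv_modulus _ _ Hz).
  assert (T2 := pt_ge2 t Ht k). assert (Zp : 0 < Cmod z) by now apply Cmod_gt_0.
  set (T := Cmod (t k)) in *.
  assert (PN : 1 <= T ^ N) by (apply pow_R1_Rle; lra).
  assert (Dp : 0 < Cmod (z - t k)).
  { destruct (Cmod_ge_0 (z - t k)) as [|E]; [assumption|]. rewrite <- E in Hi. lra. }
  assert (PC : 0 < 2 / c) by (apply Rdiv_lt_0_compat; lra).
  rewrite pow_add, pow_1.
  apply Rmult_le_reg_r with (Cmod (z - t k)); [exact Dp|].
  replace (Cmod z * / Cmod (z - t k) * Cmod (z - t k)) with (Cmod z) by (field; lra).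
  destruct (Rle_or_lt (2 * T) (Cmod z)) as [H|H].
  - assert (E := Cmod_sub_ge z (t k)). fold T in E.
    apply Rle_trans with (2 * Cmod (z - t k)); [lra|].
    apply Rmult_le_compat_r; [lra|].
    assert (1 <= T ^ N * T) by nra. nra.
  - apply Rle_trans with (2 / c * (T ^ N * T) * Cmod (z - t k)).
    + replace (2 / c * (T ^ N * T) * Cmod (z - t k))
        with (2 / c * T * (Cmod (z - t k) * T ^ N)) by ring.
      apply Rle_trans with (2 / c * T * c); [replace (2 / c * T * c) with (2 * T) by (field; lra); lra|].
      apply Rmult_le_compat_l; [nra|exact Hi].
    + apply Rmult_le_compat_r; [lra|]. apply Rmult_le_compat_r; nra.
Qed.

Lemma neq_0_of_ge_1 (z : C) : 1 <= Cmod z -> z <> RtoC 0.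
Proof. intro H. apply Cmod_gt_0. lra. Qed.

Lemma pt_neq_0 (k : nat) : t k <> RtoC 0.
Proof. apply neq_0_of_ge_1. assert (T2 := pt_ge2 t Ht k). lra. Qed.

(** Decay at the price of a constant depending on [z]: poles with [|t_k| >= 2 |z|] satisfy
    [|t_k - z| >= |t_k| / 2], and for the others the uniform bound is at most its value at
    [2 |z|]. *)
Lemma inv_bound_decay (z : C) (n : nat) : z <> RtoC 0 -> isolated t c N n z ->
  exists G, 0 <= G /\ forall k, k <> n -> Cmod (/ (1 - t k / z)) <= G / Cmod (t k).
Proof.
  intros Hz Hi. assert (Zp : 0 < Cmod z) by now apply Cmod_gt_0.
  assert (PC : 0 < 2 / c) by (apply Rdiv_lt_0_compat; lra).
  assert (P2 : 0 < (2 * Cmod z) ^ (N + 2)) by (apply pow_lt; lra).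
  exists (2 * Cmod z + (2 + 2 / c) * (2 * Cmod z) ^ (N + 2)). split; [nra|].
  intros k Hk. assert (T2 := pt_ge2 t Ht k). set (T := Cmod (t k)) in *.
  apply Rmult_le_reg_r with T; [lra|].
  match goal with |- _ <= ?X / T * T => replace (X / T * T) with X by (field; lra) end.
  destruct (Rle_or_lt (2 * Cmod z) T) as [H|H].
  - rewrite (inv_modulus _ _ Hz). assert (E := Cmod_sub_ge (t k) z). fold T in E.
    rewrite Cmod_sub_sym. set (D := Cmod (t k - z)) in *.
    apply Rle_trans with (2 * Cmod z); [|nra].
    apply Rmult_le_reg_r with D; [lra|].
    replace (Cmod z * / D * T * D) with (Cmod z * T) by (field; lra). nra.
  - assert (B := inv_bound_uniform z n k Hz Hi Hk). fold T in B.
    apply Rle_trans with ((2 + 2 / c) * T ^ (N + 1) * T); [apply Rmult_le_compat_r; lra|].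
    replace ((2 + 2 / c) * T ^ (N + 1) * T) with ((2 + 2 / c) * T ^ (N + 2))
      by (rewrite !pow_add; simpl; ring).
    assert (T ^ (N + 2) <= (2 * Cmod z) ^ (N + 2)) by (apply pow_incr; lra). nra.
Qed.

Lemma num_bound (y : C) (k : nat) : 1 <= Cmod y -> Cmod (1 - t k / y) <= 2 * Cmod (t k).
Proof.
  intro H. assert (T2 := pt_ge2 t Ht k).
  eapply Rle_trans; [apply Cmod_sub_le|].
  rewrite Cmod_1, Cmod_div by now apply neq_0_of_ge_1.
  assert (Cmod (t k) / Cmod y <= Cmod (t k)); [|lra].
  apply Rmult_le_reg_r with (Cmod y); [lra|].
  unfold Rdiv. rewrite Rmult_assoc, Rinv_l, Rmult_1_r by lra. nra.
Qed.

Lemma mfac_center (u : quad) : mfac t u (t (qn u)) = RtoC 0.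
Proof. unfold mfac, Cdiv. rewrite (Cinv_r (t (qn u)) (pt_neq_0 _)). ring. Qed.

Lemma mfac_target (u : quad) : qs u <> RtoC 0 -> mfac t u (qs u) = RtoC 0.
Proof. intro H. unfold mfac. unfold Cdiv at 2. rewrite (Cinv_r (qs u) H). ring. Qed.

Lemma hfac_center (u : quad) : hfac t u (t (qn u)) = RtoC 0.
Proof. unfold hfac, Cdiv. rewrite (Cinv_r (t (qn u)) (pt_neq_0 _)). ring. Qed.

Lemma fac_denominators (u : quad) : far t 1 u -> admissible t c N u ->
  exists G, 0 <= G /\ forall k, k <> qn u ->
    Cmod (/ (1 - t k / qz u)) * Cmod (/ (1 - t k / qw u)) * (Cmod (t k) * Cmod (t k)) <= G.
Proof.
  intros (F1 & F2 & F3 & F4) [A1 A2].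
  destruct (inv_bound_decay _ _ (neq_0_of_ge_1 _ F1) A1) as [G1 [P1 B1]].
  destruct (inv_bound_decay _ _ (neq_0_of_ge_1 _ F2) A2) as [G2 [P2 B2]].
  exists (G1 * G2). split; [nra|]. intros k Hk. specialize (B1 k Hk). specialize (B2 k Hk).
  assert (T2 := pt_ge2 t Ht k). set (T := Cmod (t k)) in *.
  replace (G1 * G2) with (G1 / T * (G2 / T) * (T * T)) by (field; lra).
  apply Rmult_le_compat_r; [nra|].
  apply Rmult_le_compat; try apply Cmod_ge_0; assumption.
Qed.

Lemma mfac_bounded (u : quad) : far t 1 u -> admissible t c N u ->
  exists G, 0 <= G /\ forall k, Cmod (mfac t u (t k)) <= G.
Proof.
  intros F Ad. destruct (fac_denominators u F Ad) as [G [HG B]].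
  destruct F as (F1 & F2 & F3 & F4).
  exists (4 * G). split; [lra|]. intro k.
  destruct (Nat.eq_dec k (qn u)) as [->|Hk].
  - rewrite mfac_center, Cmod_0. lra.
  - specialize (B k Hk). unfold mfac. rewrite !Cmod_mult.
    assert (E1 := num_bound _ k F3). assert (E2 := num_bound _ k F4).
    assert (Q1 := Cmod_ge_0 (1 - t k / t (qn u))). assert (Q2 := Cmod_ge_0 (1 - t k / qs u)).
    assert (Q3 := Cmod_ge_0 (/ (1 - t k / qz u))). assert (Q4 := Cmod_ge_0 (/ (1 - t k / qw u))).
    assert (T2 := pt_ge2 t Ht k).
    rewrite (Rmult_assoc (Cmod (1 - t k / t (qn u)) * Cmod (1 - t k / qs u))).
    apply Rle_trans with (2 * Cmod (t k) * (2 * Cmod (t k)) *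
       (Cmod (/ (1 - t k / qz u)) * Cmod (/ (1 - t k / qw u)))); [|nra].
    apply Rmult_le_compat_r; [nra|]. apply Rmult_le_compat; assumption.
Qed.

Lemma hfac_decay (u : quad) : far t 1 u -> admissible t c N u ->
  exists G, 0 <= G /\ forall k, Cmod (hfac t u (t k)) <= G / Cmod (t k).
Proof.
  intros F Ad. destruct (fac_denominators u F Ad) as [G [HG B]].
  destruct F as (F1 & F2 & F3 & F4).
  exists (2 * G). split; [lra|]. intro k. assert (T2 := pt_ge2 t Ht k).
  destruct (Nat.eq_dec k (qn u)) as [->|Hk].
  - rewrite hfac_center, Cmod_0. apply Rdiv_le_0_compat; lra.
  - specialize (B k Hk). unfold hfac. rewrite !Cmod_mult, Rmult_assoc.
    assert (E1 := num_bound _ k F3).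
    assert (Q1 := Cmod_ge_0 (1 - t k / t (qn u))).
    assert (Q3 := Cmod_ge_0 (/ (1 - t k / qz u))). assert (Q4 := Cmod_ge_0 (/ (1 - t k / qw u))).
    set (T := Cmod (t k)) in *.
    apply Rle_trans with (2 * T * (Cmod (/ (1 - t k / qz u)) * Cmod (/ (1 - t k / qw u)))).
    + apply Rmult_le_compat_r; [nra|exact E1].
    + apply Rmult_le_reg_r with T; [lra|].
      replace (2 * G / T * T) with (2 * G) by (field; lra). nra.
Qed.

Lemma mprod_bounded (l : list quad) : List.Forall (fun u => far t 1 u /\ admissible t c N u) l ->
  exists G, 0 <= G /\ forall k, Cmod (mprod t l (t k)) <= G.
Proof.
  induction 1 as [|u l [F Ad] _ [G [HG IH]]].
  - exists 1. split; [lra|]. intro k. simpl. rewrite Cmod_1. lra.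
  - destruct (mfac_bounded u F Ad) as [G' [HG' B]].
    exists (G' * G). split; [nra|]. intro k. simpl. rewrite Cmod_mult.
    apply Rmult_le_compat; try apply Cmod_ge_0; auto.
Qed.

Lemma hprod_decay (l : list quad) : List.Forall (fun u => far t 1 u /\ admissible t c N u) l ->
  exists G, 0 <= G /\ forall k, Cmod (hprod t l (t k)) * Cmod (t k) ^ length l <= G.
Proof.
  induction 1 as [|u l [F Ad] _ [G [HG IH]]].
  - exists 1. split; [lra|]. intro k. simpl. rewrite Cmod_1. lra.
  - destruct (hfac_decay u F Ad) as [G' [HG' B]].
    exists (G' * G). split; [nra|]. intro k. simpl. rewrite Cmod_mult.
    specialize (B k). specialize (IH k). assert (T2 := pt_ge2 t Ht k).
    set (T := Cmod (t k)) in *.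
    replace (Cmod (hfac t u (t k)) * Cmod (hprod t l (t k)) * (T * T ^ length l))
      with ((Cmod (hfac t u (t k)) * T) * (Cmod (hprod t l (t k)) * T ^ length l)) by ring.
    assert (0 <= T ^ length l) by (apply pow_le; lra).
    apply Rmult_le_compat.
    + apply Rmult_le_pos; [apply Cmod_ge_0|lra].
    + apply Rmult_le_pos; [apply Cmod_ge_0|lra].
    + apply Rmult_le_compat_r with (r := T) in B; [|lra].
      replace (G' / T * T) with G' in B by (field; lra). exact B.
    + exact IH.
Qed.

Lemma mfac_growth : exists K, 0 <= K /\ forall u, far t 1 u -> admissible t c N u ->
  forall k, Cmod (mfac t u (t k) - 1) <= K * Cmod (t k) ^ (2 * N + 4).
Proof.
  assert (PC : 0 < 2 / c) by (apply Rdiv_lt_0_compat; lra).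
  set (K1 := 2 + 2 / c). assert (HK1 : 0 < K1) by (unfold K1; lra).
  exists (4 * (K1 * K1) + 1). split; [nra|]. intros u (F1 & F2 & F3 & F4) [A1 A2] k.
  assert (T2 := pt_ge2 t Ht k). set (T := Cmod (t k)) in *.
  assert (PT : 1 <= T ^ (2 * N + 4)) by (apply pow_R1_Rle; lra).
  assert (Cmod (mfac t u (t k)) <= 4 * (K1 * K1) * T ^ (2 * N + 4)).
  { destruct (Nat.eq_dec k (qn u)) as [->|Hk].
    - rewrite mfac_center, Cmod_0. nra.
    - assert (E1 := num_bound _ k F3). assert (E2 := num_bound _ k F4).
      assert (B1 := inv_bound_uniform _ _ k (neq_0_of_ge_1 _ F1) A1 Hk).
      assert (B2 := inv_bound_uniform _ _ k (neq_0_of_ge_1 _ F2) A2 Hk).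
      fold T K1 in B1, B2, E1, E2. unfold mfac. rewrite !Cmod_mult.
      replace (4 * (K1 * K1) * T ^ (2 * N + 4))
        with (2 * T * (2 * T) * (K1 * T ^ (N + 1)) * (K1 * T ^ (N + 1))).
      2:{ replace (2 * N + 4)%nat with (N + 1 + (N + 1) + 2)%nat by lia.
          rewrite !pow_add. ring. }
      assert (P1 := Cmod_ge_0 (1 - t k / t (qn u))). assert (P2 := Cmod_ge_0 (1 - t k / qs u)).
      assert (P3 := Cmod_ge_0 (/ (1 - t k / qz u))). assert (P4 := Cmod_ge_0 (/ (1 - t k / qw u))).
      repeat apply Rmult_le_compat; try assumption; repeat apply Rmult_le_pos; assumption. }
  eapply Rle_trans; [apply Cmod_sub_le|]. rewrite Cmod_1. nra.
Qed.

(** For [d <= 1/4] each of [x y - x - y] and [z w - z - w] is at most [3 d], and the two inverses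
    together are at most [16/9 < 4]; hence [6 * 4 = 24]. *)
Lemma mfac_near_1 (u : quad) (s : C) (d : R) : d <= 1 / 4 ->
  Cmod (s / t (qn u)) <= d -> Cmod (s / qs u) <= d ->
  Cmod (s / qz u) <= d -> Cmod (s / qw u) <= d ->
  Cmod (mfac t u s - 1) <= 24 * d.
Proof.
  intros Hd. unfold mfac.
  set (x := (s / t (qn u))%C). set (y := (s / qs u)%C).
  set (z := (s / qz u)%C). set (w := (s / qw u)%C). intros Hx Hy Hz Hw.
  assert (Px := Cmod_ge_0 x). assert (Py := Cmod_ge_0 y).
  assert (Lz : 3 / 4 <= Cmod (1 - z)).
  { assert (E := Cmod_sub_ge 1 z). rewrite Cmod_1 in E. lra. }
  assert (Lw : 3 / 4 <= Cmod (1 - w)).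
  { assert (E := Cmod_sub_ge 1 w). rewrite Cmod_1 in E. lra. }
  assert (Nz : (1 - z)%C <> RtoC 0) by (apply Cmod_gt_0; lra).
  assert (Nw : (1 - w)%C <> RtoC 0) by (apply Cmod_gt_0; lra).
  replace ((1 - x) * (1 - y) * / (1 - z) * / (1 - w) - 1)%C
    with ((x * y - x - y - (z * w - z - w)) * (/ (1 - z) * / (1 - w)))%C
    by (field; split; assumption).
  assert (E1 : Cmod (x * y - x - y - (z * w - z - w)) <= 6 * d).
  { eapply Rle_trans; [apply Cmod_sub_le|].
    assert (Cmod (x * y - x - y) <= 3 * d).
    { eapply Rle_trans; [apply Cmod_sub_le|].
      eapply Rle_trans; [apply Rplus_le_compat_r, Cmod_sub_le|]. rewrite Cmod_mult. nra. }
    assert (Cmod (z * w - z - w) <= 3 * d).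
    { eapply Rle_trans; [apply Cmod_sub_le|].
      eapply Rle_trans; [apply Rplus_le_compat_r, Cmod_sub_le|]. rewrite Cmod_mult.
      assert (Pz := Cmod_ge_0 z). assert (Pw := Cmod_ge_0 w). nra. }
    lra. }
  rewrite Cmod_mult, (Cmod_mult (/ (1 - z))), !Cmod_Cinv.
  assert (I1 : / Cmod (1 - z) <= 4 / 3).
  { replace (4 / 3) with (/ (3 / 4)) by field. apply Rinv_le_contravar; lra. }
  assert (I2 : / Cmod (1 - w) <= 4 / 3).
  { replace (4 / 3) with (/ (3 / 4)) by field. apply Rinv_le_contravar; lra. }
  assert (J1 : 0 < / Cmod (1 - z)) by (apply Rinv_0_lt_compat; lra).
  assert (J2 : 0 < / Cmod (1 - w)) by (apply Rinv_0_lt_compat; lra).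
  apply Rle_trans with (6 * d * 4); [|lra].
  apply Rmult_le_compat; [apply Cmod_ge_0|nra|exact E1|nra].
Qed.

(** For [|t k| >= L] the decay of [b] beats the growth of the multiplier by one power, which leaves
    [G K / |t k| <= e]. For [|t k| < L] a pair beyond [L * M] makes all four ratios at most [1 / M],
    so that the multiplier is within [24 / M] of 1. *)
Lemma mfac_step (G e : R) : 0 <= G -> 0 < e -> exists B, 1 <= B /\
  forall u, far t B u -> admissible t c N u ->
  forall k b, Cmod b * Cmod (t k) ^ (2 * N + 5) <= G ->
  Cmod (b * (mfac t u (t k) - 1)) <= e.
Proof.
  intros HG He. destruct mfac_growth as [K [HK Hgr]].
  set (L := G * K / e + 1).
  assert (HL : 1 <= L).
  { assert (0 <= G * K / e) by (apply Rdiv_le_0_compat; nra). unfold L. lra. }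
  set (M := 4 + 24 * G / e).
  assert (HM : 4 <= M).
  { assert (0 <= 24 * G / e) by (apply Rdiv_le_0_compat; lra). unfold M. lra. }
  exists (L * M). split; [nra|].
  intros u (F1 & F2 & F3 & F4) Ad k b Hb. rewrite Cmod_mult.
  assert (T2 := pt_ge2 t Ht k). set (T := Cmod (t k)) in *.
  assert (Pb := Cmod_ge_0 b).
  assert (F : far t 1 u) by (repeat split; nra).
  destruct (Rle_or_lt L T) as [H|H].
  - specialize (Hgr u F Ad k). fold T in Hgr.
    assert (PT : 0 < T ^ (2 * N + 4)) by (apply pow_lt; lra).
    apply Rle_trans with (Cmod b * (K * T ^ (2 * N + 4))).
    { apply Rmult_le_compat_l; assumption. }
    replace (2 * N + 5)%nat with (2 * N + 4 + 1)%nat in Hb by lia.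
    rewrite pow_add, pow_1 in Hb.
    assert (X : G * K <= e * T).
    { apply Rle_trans with (e * L); [|nra]. unfold L.
      replace (e * (G * K / e + 1)) with (G * K + e) by (field; lra). lra. }
    apply Rmult_le_reg_r with T; [lra|].
    replace (Cmod b * (K * T ^ (2 * N + 4)) * T) with (Cmod b * (T ^ (2 * N + 4) * T) * K) by ring.
    apply Rle_trans with (G * K); [|exact X]. apply Rmult_le_compat_r; assumption.
  - assert (Hb' : Cmod b <= G).
    { assert (1 <= T ^ (2 * N + 5)) by (apply pow_R1_Rle; lra). nra. }
    assert (Hs : forall y, L * M <= Cmod y -> Cmod (t k / y) <= / M).
    { intros y Hy. rewrite Cmod_div by (apply neq_0_of_ge_1; nra). fold T.
      apply Rmult_le_reg_r with (Cmod y); [nra|].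
      unfold Rdiv. rewrite Rmult_assoc, Rinv_l, Rmult_1_r by nra.
      apply Rle_trans with (/ M * (L * M)).
      - replace (/ M * (L * M)) with L by (field; lra). lra.
      - apply Rmult_le_compat_l; [|exact Hy]. left. apply Rinv_0_lt_compat. lra. }
    assert (E := mfac_near_1 u (t k) (/ M) ltac:(replace (1 / 4) with (/ 4) by field;
      apply Rinv_le_contravar; lra) (Hs _ F3) (Hs _ F4) (Hs _ F1) (Hs _ F2)).
    apply Rle_trans with (G * (24 * / M)).
    { apply Rmult_le_compat; try apply Cmod_ge_0; assumption. }
    apply Rmult_le_reg_r with M; [lra|].
    replace (G * (24 * / M) * M) with (24 * G) by (field; lra).
    unfold M. replace (e * (4 + 24 * G / e)) with (4 * e + 24 * G) by (field; lra). lra.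
Qed.

Lemma not_center (u : quad) (k : nat) : admissible t c N u -> k <> qn u ->
  t k <> qz u /\ t k <> qw u.
Proof.
  intros [A1 A2] Hk. specialize (A1 k Hk). specialize (A2 k Hk). split; intro E.
  - rewrite E in A1. replace (qz u - qz u)%C with (RtoC 0) in A1 by ring.
    rewrite Cmod_0 in A1. lra.
  - rewrite E in A2. replace (qw u - qw u)%C with (RtoC 0) in A2 by ring.
    rewrite Cmod_0 in A2. lra.
Qed.

Lemma one_sub_div_neq (s y : C) : y <> RtoC 0 -> s <> y -> (1 - s / y)%C <> RtoC 0.
Proof.
  intros Hy Hs E. apply Hs.
  replace s with (y * (1 - (1 - s / y)))%C by (field; exact Hy). rewrite E. ring.
Qed.

(** The identity holds at the centre too, where both sides are 0; there a zero of the pair may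
    coincide with the pole. *)
Lemma mfac_cancel (u : quad) : far t 1 u -> admissible t c N u ->
  exists K, forall k, ((t k - qz u) * (t k - qw u) * mfac t u (t k) =
    K * ((t k - t (qn u)) * (t k - qs u)))%C.
Proof.
  intros (F1 & F2 & F3 & F4) Ad. apply neq_0_of_ge_1 in F1, F2, F3, F4.
  exists (qz u * qw u / (t (qn u) * qs u))%C. intro k.
  destruct (Nat.eq_dec k (qn u)) as [->|Hk].
  - rewrite mfac_center. ring.
  - destruct (not_center u k Ad Hk) as [N1 N2]. unfold mfac. field.
    repeat split; try assumption; apply Csub_neq_0; congruence.
Qed.

Lemma hfac_cancel (u : quad) : far t 1 u -> admissible t c N u ->
  exists K, forall k, ((t k - qz u) * (t k - qw u) * hfac t u (t k) =
    K * (t k - t (qn u)))%C.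
Proof.
  intros (F1 & F2 & F3 & F4) Ad. apply neq_0_of_ge_1 in F1, F2, F3, F4.
  exists (- (qz u * qw u / t (qn u)))%C. intro k.
  destruct (Nat.eq_dec k (qn u)) as [->|Hk].
  - rewrite hfac_center. ring.
  - destruct (not_center u k Ad Hk) as [N1 N2]. unfold hfac. field.
    repeat split; try assumption; apply Csub_neq_0; congruence.
Qed.

Lemma mprod_cancel (l : list quad) : List.Forall (fun u => far t 1 u /\ admissible t c N u) l ->
  exists K, forall k, (lprod (zlist l) (t k) * mprod t l (t k) = K * lprod (ylist t l) (t k))%C.
Proof.
  induction 1 as [|u l [F Ad] _ [K IH]].
  - exists (RtoC 1). intro k. simpl. ring.
  - destruct (mfac_cancel u F Ad) as [K' HK']. exists (K' * K)%C. intro k. simpl.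
    transitivity (((t k - qz u) * (t k - qw u) * mfac t u (t k)) *
       (lprod (zlist l) (t k) * mprod t l (t k)))%C; [ring|].
    rewrite HK', IH. ring.
Qed.

Lemma hprod_cancel (l : list quad) : List.Forall (fun u => far t 1 u /\ admissible t c N u) l ->
  exists K, forall k, (lprod (zlist l) (t k) * hprod t l (t k) = K * lprod (nlist t l) (t k))%C.
Proof.
  induction 1 as [|u l [F Ad] _ [K IH]].
  - exists (RtoC 1). intro k. simpl. ring.
  - destruct (hfac_cancel u F Ad) as [K' HK']. exists (K' * K)%C. intro k. simpl.
    transitivity (((t k - qz u) * (t k - qw u) * hfac t u (t k)) *
       (lprod (zlist l) (t k) * hprod t l (t k)))%C; [ring|].
    rewrite HK', IH. ring.
Qed.

Lemma ylist_extract (l : list quad) (u : quad) : In u l ->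
  exists ys, (length ys + 2 = 2 * length l)%nat /\
    forall s, (lprod (ylist t l) s = (s - qs u) * ((s - t (qn u)) * lprod ys s))%C.
Proof.
  assert (Hlen : forall l', length (ylist t l') = (2 * length l')%nat).
  { induction l' as [|v l' IH]; simpl; [reflexivity|]. rewrite IH. lia. }
  induction l as [|v l IH]; [intros []|]. intros [->|Hu].
  - exists (ylist t l). split; [rewrite Hlen; simpl; lia|]. intro s. simpl. ring.
  - destruct (IH Hu) as [ys [H1 H2]]. exists (t (qn v) :: qs v :: ys).
    split; [simpl; lia|]. intro s. simpl. rewrite H2. ring.
Qed.

Lemma zlist_app (l l' : list quad) : zlist (l ++ l') = zlist l ++ zlist l'.
Proof. unfold zlist. apply flat_map_app. Qed.

Lemma zlist_length (l : list quad) : length (zlist l) = (2 * length l)%nat.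
Proof. induction l as [|u l IH]; simpl; [reflexivity|]. rewrite IH. lia. Qed.

(** The factor [t k - qs u] of the moved product cancels the denominator of the transform. What
    remains is, up to a constant, a moment of [q] of degree [2|l| - 1 + |l0|], less than the number
    [2|l| + 2|l0|] of zeros, hence 0. If [qs u = t (qn u)], the term at this pole is 0 by the
    convention [/ 0 = 0], in agreement with the factor [t k - t (qn u)] left in the moment. *)
Lemma CT_moved_zero (x q : nat -> C) (l l0 : list quad) (u : quad) :
  List.Forall (fun u => far t 1 u /\ admissible t c N u) (l ++ l0) ->
  Quot t x (zlist (l ++ l0)) q -> In u l -> (off t (qs u) \/ qs u = t (qn u)) ->
  CT t (fun k => x k * (mprod t l (t k) * hprod t l0 (t k)))%C (qs u) = RtoC 0.
Proof.
  intros HF (Q1 & _ & Q3 & _) Hu Hs. apply List.Forall_app in HF. destruct HF as [HF1 HF2].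
  destruct (mprod_cancel l HF1) as [K1 C1]. destruct (hprod_cancel l0 HF2) as [K2 C2].
  destruct (ylist_extract l u Hu) as [ys [L1 L2]].
  assert (E := Q3 (t (qn u) :: ys ++ nlist t l0)).
  assert (Hlen : (length (t (qn u) :: ys ++ nlist t l0) < length (zlist (l ++ l0)))%nat).
  { rewrite zlist_length. simpl. rewrite !length_app. unfold nlist. rewrite length_map. lia. }
  specialize (E Hlen). apply (Cseries_scal (- (K1 * K2))%C) in E.
  replace (- (K1 * K2) * RtoC 0)%C with (RtoC 0) in E by ring.
  apply csum_unique. revert E. apply Cseries_ext. intro k.
  rewrite Q1, zlist_app, lprod_app. simpl. rewrite lprod_app.
  transitivity ((lprod (zlist l) (t k) * mprod t l (t k)) * (lprod (zlist l0) (t k) * hprod t l0 (t k))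
    * q k / (qs u - t k))%C; [|unfold Cdiv; ring].
  rewrite C1, C2, L2.
  destruct (classic (t k = qs u)) as [Ek|Nk].
  - destruct Hs as [Hs|Hs]; [now elim (Hs k)|].
    rewrite Ek, Hs. unfold Cdiv. ring.
  - field. apply Csub_neq_0. congruence.
Qed.

End Factors.

(** * The infinite product of multipliers *)

Section Transfer.
Context (t : nat -> C) (Ht : point_seq t) (A : C -> C) (HA : gen t A).
Context (c : R) (N : nat) (Hc : 0 < c).
Context (x : nat -> C) (f : C -> C) (Hf : transform t A x f).
Context (V : quad -> Prop).
Context (HV : forall u, V u -> admissible t c N u /\ zero_pair f (qz u) (qw u)).
Context (Hfar : forall B, exists u, V u /\ far t B u).

Lemma good_Forall (l : list quad) :
  good t V l -> List.Forall (fun u => far t 1 u /\ admissible t c N u) l.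
Proof.
  induction l as [|u l IH]; intro H; constructor.
  - destruct H as (H1 & H2 & _). split; [exact H2|now apply HV].
  - apply IH, H.
Qed.

Lemma good_Quot (l : list quad) : good t V l -> exists q, Quot t x (zlist l) q.
Proof.
  induction l as [|u l IH]; intro H.
  - exists x. apply Quot_nil, Hf.
  - destruct H as (H1 & _ & H3 & H4). destruct (IH H4) as [q Hq].
    assert (Nz : ~ In (qz u) (zlist l)) by (intro E; apply H3 in E; lra).
    assert (Nw : ~ In (qw u) (zlist l)) by (intro E; apply H3 in E; lra).
    rewrite <- lprod_eq_0 in Nz, Nw.
    destruct (proj2 (HV u H1)) as [(D & Z1 & Z2)|(D & Z1 & Z2)].
    + destruct (Quot_cons t Ht x q (zlist l) (qw u) Hq) as [q1 Hq1].
      { now apply (vanish_simple t Ht A HA x q f (zlist l)). }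
      apply (Quot_cons t Ht x q1 (qw u :: zlist l) (qz u) Hq1).
      apply (vanish_simple t Ht A HA x q1 f (qw u :: zlist l) _ Hf Hq1 Z1).
      rewrite lprod_eq_0 in Nz |- *. intros [E|E]; [now symmetry in E|contradiction].
    + simpl. rewrite <- D in *.
      destruct (Quot_cons t Ht x q (zlist l) (qz u) Hq) as [q1 Hq1].
      { now apply (vanish_simple t Ht A HA x q f (zlist l)). }
      apply (Quot_cons t Ht x q1 (qz u :: zlist l) (qz u) Hq1).
      now apply (vanish_double t Ht A HA x q1 f (zlist l)).
Qed.

Lemma good_extend (l : list quad) (B : R) : good t V l ->
  exists u, V u /\ far t B u /\ good t V (u :: l).
Proof.
  intro Hl. destruct (modulus_bound (zlist l)) as [M HM].
  destruct (Hfar (Rmax B (Rmax 1 M))) as [u [Hu F]].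
  assert (E1 := Rmax_l B (Rmax 1 M)). assert (E2 := Rmax_r B (Rmax 1 M)).
  assert (E3 := Rmax_l 1 M). assert (E4 := Rmax_r 1 M).
  destruct F as (F1 & F2 & F3 & F4).
  exists u. split; [exact Hu|]. split; [repeat split; lra|].
  split; [exact Hu|]. split; [repeat split; lra|]. split; [|exact Hl].
  intros z Hz. specialize (HM z Hz). lra.
Qed.

Lemma good_initial (B : R) (p : nat) :
  exists l, length l = p /\ good t V l /\ List.Forall (fun u => B < Cmod (t (qn u))) l.
Proof.
  induction p as [|p (l & H1 & H2 & H3)].
  - exists nil. repeat split. constructor.
  - destruct (good_extend l (B + 1) H2) as (u & Hu & F & G).
    exists (u :: l). split; [simpl; congruence|]. split; [exact G|].
    constructor; [|exact H3]. destruct F as (_ & _ & F & _). lra.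
Qed.

Lemma hprod_neq_0 (k : nat) (l : list quad) : good t V l ->
  List.Forall (fun u => Cmod (t k) < Cmod (t (qn u))) l -> hprod t l (t k) <> RtoC 0.
Proof.
  intros G H. apply good_Forall in G. induction H as [|u l Hu _ IH].
  - simpl. apply Cmod_gt_0. rewrite Cmod_1. lra.
  - inversion_clear G as [|? ? [F Ad] G']. simpl. apply Cmult_neq_0; [|now apply IH].
    assert (Hk : k <> qn u) by (intros ->; lra).
    destruct (not_center t c N Hc u k Ad Hk) as [N1 N2].
    destruct F as (F1 & F2 & F3 & F4). apply neq_0_of_ge_1 in F1, F2, F3.
    assert (Ni : forall y : C, y <> RtoC 0 -> (/ y)%C <> RtoC 0).
    { intros y Hy. apply Cmod_gt_0. rewrite Cmod_Cinv. apply Rinv_0_lt_compat. now apply Cmod_gt_0. }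
    unfold hfac. repeat apply Cmult_neq_0; [|apply Ni|apply Ni]; apply one_sub_div_neq; try assumption.
    intro E. now apply (pt_inj t Ht) in E.
Qed.

(** [beta] is the limit of the finite products, uniform over all poles. A moved zero is an exact
    zero for every finite product that includes its pair, and uniform convergence carries it to the
    limit. *)
Theorem zeros_transfer : (exists m, x m <> RtoC 0) ->
  exists (beta : nat -> C) (K : R) (g : C -> C),
    0 <= K /\ (forall k, Cmod (beta k) <= K) /\
    transform t A (fun k => x k * beta k)%C g /\
    (exists m, (x m * beta m)%C <> RtoC 0) /\
    forall B, exists u, V u /\ B < Cmod (qs u) /\ g (qs u) = RtoC 0 /\
      (qs u = t (qn u) -> Cderiv g (qs u) (RtoC 0)).
Proof.
  intros [k0 Hk0].
  (* Centres of modulus greater than [|t k0|] keep the initial factors from vanishing at [t k0]. *)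
  destruct (good_initial (Cmod (t k0)) (2 * N + 5)) as (l0 & L0 & G0 & Hl0).
  set (b0 := fun k => hprod t l0 (t k)).
  assert (Hb0 : 0 < Cmod (b0 k0)) by (apply Cmod_gt_0; now apply hprod_neq_0).
  (* All later corrections add up to at most [2 * e], half of [|b0 k0|], so the weight at [k0]
     survives in the limit. *)
  set (e := Cmod (b0 k0) / 4). assert (He : 0 < e) by (unfold e; lra).
  destruct (hprod_decay t Ht c N Hc l0 (good_Forall l0 G0)) as [H0 [PH0 HH0]].
  rewrite L0 in HH0.
  (* Besides the geometric smallness at all poles, the modulus of each target is required to exceed
     the number of earlier pairs, which makes the targets unbounded. *)
  destruct (list_choice (fun l => good t V (l ++ l0))
    (fun l u => V u /\ far t 1 u /\ INR (length l) < Cmod (qs u) /\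
       forall k, Cmod (mprod t l (t k) * b0 k * (mfac t u (t k) - 1)) <= e * (1 / 2) ^ length l))
    as (us & ls & Hnil & Hls).
  { exact G0. }
  { intros l Hl.
    assert (HFl := good_Forall _ Hl). apply List.Forall_app in HFl.
    destruct (mprod_bounded t Ht c N Hc l (proj1 HFl)) as [G [PG HG]].
    destruct (mfac_step t Ht c N Hc (G * H0) (e * (1 / 2) ^ length l)) as [B [HB Hstep]].
    { nra. }
    { apply Rmult_lt_0_compat; [lra|apply pow_lt; lra]. }
    destruct (good_extend (l ++ l0) (B + INR (length l) + 1) Hl) as (u & Hu & F & Gu).
    assert (PI := pos_INR (length l)).
    exists u. split; [|exact Gu]. destruct F as (F1 & F2 & F3 & F4).
    split; [exact Hu|]. split; [repeat split; lra|]. split; [lra|].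
    intro k. apply Hstep; [repeat split; lra|now apply HV|].
    rewrite Cmod_mult, Rmult_assoc.
    apply Rmult_le_compat; [apply Cmod_ge_0| |apply HG|apply HH0].
    apply Rmult_le_pos; [apply Cmod_ge_0|]. apply pow_le. apply Cmod_ge_0. }
  assert (Hlen : forall j, length (ls j) = j).
  { induction j as [|j IH]; [now rewrite Hnil|]. rewrite (proj1 (Hls j)). simpl. now rewrite IH. }
  assert (Hin : forall j i, (i < j)%nat -> In (us i) (ls j)).
  { induction j as [|j IH]; [lia|]. intros i Hi. rewrite (proj1 (Hls j)).
    destruct (Nat.eq_dec i j) as [->|]; [now left|right; apply IH; lia]. }
  set (v := fun k j => (mprod t (ls j) (t k) * b0 k)%C).
  assert (Hv : forall k, exists l, forall J, Cmod (l - v k J) <= 2 * e * (1 / 2) ^ J).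
  { intro k. apply geometric_limit. intro j.
    destruct (Hls j) as (E & (_ & _ & _ & R) & _). specialize (R k). rewrite Hlen in R.
    unfold v at 1. rewrite E. simpl.
    replace (mfac t (us j) (t k) * mprod t (ls j) (t k) * b0 k - v k j)%C
      with (mprod t (ls j) (t k) * b0 k * (mfac t (us j) (t k) - 1))%C by (unfold v; ring).
    exact R. }
  set (beta := fun k => proj1_sig (constructive_indefinite_description _ (Hv k))).
  assert (Hbeta : forall k J, Cmod (beta k - v k J) <= 2 * e * (1 / 2) ^ J).
  { intro k. unfold beta. destruct (constructive_indefinite_description _ (Hv k)) as [y Hy]. exact Hy. }
  clearbody beta.
  assert (Hv0 : forall k, v k 0%nat = b0 k) by (intro k; unfold v; rewrite Hnil; simpl; ring).
  assert (HK : forall k, Cmod (beta k) <= H0 + 2 * e).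
  { intro k. replace (beta k) with (v k 0%nat + (beta k - v k 0%nat))%C by ring.
    eapply Rle_trans; [apply Cmod_triangle|]. specialize (Hbeta k 0%nat). simpl in Hbeta.
    assert (Cmod (v k 0%nat) <= H0); [|lra].
    rewrite Hv0. eapply Rle_trans; [|apply (HH0 k)]. fold (b0 k).
    assert (T2 := pt_ge2 t Ht k).
    assert (1 <= Cmod (t k) ^ (2 * N + 5)) by (apply pow_R1_Rle; lra).
    assert (P := Cmod_ge_0 (b0 k)). nra. }
  destruct (multiplier t Ht A HA x beta f (H0 + 2 * e) Hf ltac:(lra) HK) as (g & Hg & Gpole & Gder).
  exists beta, (H0 + 2 * e), g. split; [lra|]. split; [exact HK|]. split; [exact Hg|]. split.
  { exists k0. apply Cmult_neq_0; [exact Hk0|]. intro E.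
    specialize (Hbeta k0 0%nat). rewrite Hv0, E in Hbeta. simpl in Hbeta.
    replace (RtoC 0 - b0 k0)%C with (- b0 k0)%C in Hbeta by ring. rewrite Cmod_opp in Hbeta.
    unfold e in Hbeta. lra. }
  (* With [n] the integer part of [Rmax 0 B], the pair of index [n + 1] has a target of modulus
     above [n + 1 > B]. *)
  intro B. destruct (nfloor_ex (Rmax 0 B) (Rmax_l 0 B)) as [n [_ Hn]].
  set (i := S n). set (u := us i).
  destruct (Hls i) as (_ & (Vu & Fu & Bu & _) & _). fold u in Vu, Fu, Bu. rewrite Hlen in Bu.
  exists u. split; [exact Vu|]. split.
  { assert (M := Rmax_r 0 B). unfold i in Bu. rewrite S_INR in Bu. lra. }
  (* A zero of a single factor makes every finite product containing it exactly 0, hence also the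
     limit. *)
  assert (Hdead : forall k, mfac t u (t k) = RtoC 0 -> beta k = RtoC 0).
  { intros k Hk. apply Cmod_eq_0. apply Rle_antisym; [|apply Cmod_ge_0].
    apply half_pow_le_0 with (2 * e). intro J.
    assert (Vj : forall j, (i < j)%nat -> v k j = RtoC 0).
    { intros j Hj. unfold v. apply Hin in Hj. fold u in Hj.
      assert (mprod t (ls j) (t k) = RtoC 0) as ->; [|ring].
      induction (ls j) as [|y l IH]; [destruct Hj|]. simpl.
      destruct Hj as [->|Hj]; [rewrite Hk|rewrite (IH Hj)]; ring. }
    specialize (Hbeta k (S (i + J))). rewrite Vj in Hbeta by lia.
    replace (beta k - RtoC 0)%C with (beta k) in Hbeta by ring.
    eapply Rle_trans; [exact Hbeta|]. apply Rmult_le_compat_l; [lra|].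
    replace (S (i + J)) with (S i + J)%nat by lia. rewrite pow_add.
    assert (0 < (1 / 2) ^ J) by (apply pow_lt; lra).
    assert ((1 / 2) ^ S i <= 1).
    { apply Rle_trans with (1 ^ S i); [apply pow_incr; lra|rewrite pow1; lra]. }
    nra. }
  (* The transform at [qs u] is compared with that of the [j]-th product, which vanishes for
     [j > i]; the difference is at most a constant times [(1 / 2) ^ j]. *)
  assert (HCT : off t (qs u) \/ qs u = t (qn u) ->
     CT t (fun k => x k * beta k)%C (qs u) = RtoC 0).
  { intro Hs. destruct (CT_term_bound t Ht (qs u)) as [K [PK HKb]].
    assert (Wx : wsum t 0 x) by apply Hf. assert (Sx := proj1 (wsum_0 t x) Wx).
    set (S := Series (fun k => Cmod (x k) / Cmod (t k))) in *.
    apply Cmod_eq_0. apply Rle_antisym; [|apply Cmod_ge_0].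
    apply half_pow_le_0 with (2 * e * (1 / 2) ^ Datatypes.S i * K * S). intro J.
    set (j := (Datatypes.S i + J)%nat).
    assert (Gj : good t V (ls j ++ l0)) by apply (Hls j).
    destruct (good_Quot _ Gj) as [q Hq].
    assert (Z := CT_moved_zero t Ht c N Hc x q (ls j) l0 u (good_Forall _ Gj) Hq
      (Hin j i ltac:(unfold j; lia)) Hs).
    assert (Wv : wsum t 0 (fun k => x k * v k j)%C).
    { apply (wsum_dom t Ht 0 0 _ x (H0 + 2 * e + 2 * e * (1 / 2) ^ j)); [lia| | |exact Wx].
      - assert (0 < (1 / 2) ^ j) by (apply pow_lt; lra). nra.
      - intro k. rewrite Cmod_mult, Rmult_comm. apply Rmult_le_compat_r; [apply Cmod_ge_0|].
        replace (v k j) with (beta k - (beta k - v k j))%C by ring.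
        eapply Rle_trans; [apply Cmod_sub_le|]. apply Rplus_le_compat; auto. }
    assert (E1 := CT_series t Ht _ (qs u) (proj1 (proj2 Hg))).
    assert (E2 := Cseries_scal (-(1))%C _ _ (CT_series t Ht _ (qs u) Wv)).
    unfold v in E2 at 2. unfold b0 in E2. rewrite Z in E2.
    assert (E := Cseries_plus _ _ _ _ E1 E2). clear E1 E2.
    replace (CT t (fun k => x k * beta k)%C (qs u) + - (1) * RtoC 0)%C
      with (CT t (fun k => x k * beta k)%C (qs u)) in E by ring.
    replace (2 * e * (1 / 2) ^ Datatypes.S i * K * S * (1 / 2) ^ J) with
      (Series (fun k => 2 * e * (1 / 2) ^ j * K * (Cmod (x k) / Cmod (t k)))).
    2:{ rewrite Series_scal_l. fold S. unfold j. rewrite pow_add. ring. }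
    apply (series_bound _ _ _ E).
    2: apply (ex_series_scal (2 * e * (1 / 2) ^ j * K) _ Sx).
    intro k.
    match goal with |- Cmod ?y <= _ => replace y with ((beta k - v k j) * (x k / (qs u - t k)))%C end.
    2:{ unfold v, b0, Cdiv. ring. }
    rewrite Cmod_mult, (Rmult_assoc (2 * e * (1 / 2) ^ j)).
    apply Rmult_le_compat; try apply Cmod_ge_0; [apply Hbeta|apply HKb]. }
  assert (Sn0 : qs u <> RtoC 0) by (apply neq_0_of_ge_1, Fu).
  split.
  - destruct (off_or t (qs u)) as [Ho|[m Hm]].
    + destruct Hg as (_ & _ & Hg). rewrite (Hg _ Ho), (HCT (or_introl Ho)). ring.
    + rewrite Hm, Gpole, Hdead; [ring|]. rewrite <- Hm. now apply mfac_target.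
  (* At the centre [beta] vanishes, so the derivative of [g] is [A'] times the transform with the
     pole removed, and this transform is 0. *)
  - intro Hs. destruct (A_deriv t A HA (qn u)) as [l [Hl _]].
    assert (D := Gder (qn u) l (Hdead _ (mfac_center t Ht u)) Hl).
    rewrite <- Hs in D at 1. rewrite <- Hs, (HCT (or_intror Hs)) in D.
    replace (l * RtoC 0)%C with (RtoC 0) in D by ring. exact D.
Qed.

End Transfer.

(** * The equivalences *)

Lemma finite_bounded (P : C -> Prop) : finite_set P -> exists B, forall z, P z -> Cmod z < B.
Proof.
  intros [l Hl]. destruct (modulus_bound l) as [B HB]. exists B. auto.
Qed.

Lemma multiple_zero_deriv (f : C -> C) (z : C) :
  entire f -> (multiple_zero f z <-> f z = RtoC 0 /\ Cderiv f z (RtoC 0)).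
Proof.
  intro Hf. unfold multiple_zero. split; intros [H1 H2]; split; try assumption.
  - rewrite <- H2. apply (C_derive_correct f z (RtoC 0) (Hf z)).
  - now apply is_C_derive_unique.
Qed.

Definition separated (t : nat -> C) (K : R) (N : nat) : Prop :=
  forall n m, m <> n -> K <= Cmod (t n - t m) * Cmod (t n) ^ N.

Lemma Rpower_neg_le (T M : R) (N : nat) : 1 <= T -> M <= INR N -> / T ^ N <= Rpower T (- M).
Proof.
  intros HT HM. rewrite <- (Rpower_pow N T) by lra. rewrite <- Rpower_Ropp.
  unfold Rpower. destruct HT as [HT| <-].
  - assert (0 < ln T) by (rewrite <- ln_1; apply ln_increasing; lra).
    assert (E : - INR N * ln T <= - M * ln T) by nra.
    destruct E as [E|E]; [left; now apply exp_increasing|right; now rewrite E].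
  - rewrite ln_1. right. f_equal. ring.
Qed.

(** As [|t n| >= 1], the exponent may be rounded up to an integer. *)
Lemma power_separated_nat (t : nat -> C) : (forall n, 2 <= Cmod (t n)) ->
  power_separated t -> exists K N, 0 < K /\ separated t K N.
Proof.
  intros H2 (K & M & HK & HM & H). destruct (nfloor_ex M ltac:(lra)) as [n [_ Hn]].
  exists K, (S n). split; [exact HK|]. intros i j Hij. specialize (H i j Hij). specialize (H2 i).
  assert (E := Rpower_neg_le (Cmod (t i)) M (S n) ltac:(lra) ltac:(rewrite S_INR; lra)).
  assert (P : 0 < Cmod (t i) ^ S n) by (apply pow_lt; lra).
  apply Rle_trans with (K * / Cmod (t i) ^ S n * Cmod (t i) ^ S n).
  - right. field. lra.
  - apply Rmult_le_compat_r; [lra|]. eapply Rle_trans; [|exact H].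
    apply Rmult_le_compat_l; lra.
Qed.

Section Equivalences.
Context (t : nat -> C) (A : C -> C) (mu : nat -> R).
Context (hdata : CdB_data t A mu) (ht : forall n, 2 <= Cmod (t n)).

Lemma data_point_seq : point_seq t.
Proof.
  split; [|split; [exact ht|]].
  - intros m n E. apply NNPP. intro Hn. now apply (CdB_distinct _ _ _ hdata m n Hn).
  - intro B. assert (H := CdB_infinity _ _ _ hdata). apply is_lim_seq_spec in H.
    destruct (H B) as [L HL]. exists L. exact HL.
Qed.

Lemma data_gen : gen t A.
Proof.
  split; [apply (CdB_entire _ _ _ hdata)|]. split; [|split].
  - intros z Hz E. apply (CdB_zeros _ _ _ hdata) in E. destruct E as [n Hn]. now apply (Hz n).
  - intro n. apply (CdB_zeros _ _ _ hdata). now exists n.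
  - intros n l Hl E. assert (Z : zeros A (t n)) by (apply (CdB_zeros _ _ _ hdata); now exists n).
    destruct (CdB_simple _ _ _ hdata _ Z) as [_ D]. apply D.
    rewrite (is_C_derive_unique A (t n) l Hl). exact E.
Qed.

Lemma square_summable_wsum (a : nat -> C) :
  ex_series (fun n => Cmod (a n) ^ 2) -> wsum t 0 (fun k => a k * RtoC (sqrt (mu k)))%C.
Proof.
  intro Ha. apply wsum_0.
  assert (H := ex_series_plus _ _ Ha (CdB_mu_sum _ _ _ hdata)).
  apply ex_series_dom with (K := 1) (2 := H). intro k. specialize (ht k).
  assert (Hmu := CdB_mu_pos _ _ _ hdata k). assert (P := Cmod_ge_0 (a k)).
  rewrite Cmod_mult, Cmod_R, Rabs_pos_eq by apply sqrt_pos.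
  assert (Q := sqrt_pos (mu k)). assert (Q2 := sqrt_sqrt (mu k) ltac:(lra)).
  set (T := Cmod (t k)) in *. set (s := sqrt (mu k)) in *. set (al := Cmod (a k)) in *.
  split; [apply Rdiv_le_0_compat; [nra|lra]|].
  change (al * s / T <= 1 * (al ^ 2 + mu k / (T ^ 2 + 1))). rewrite <- Q2.
  (* AM-GM: [al s / T <= (al^2 + (s / T)^2) / 2], and [1 / T^2 <= 2 / (T^2 + 1)]. *)
  assert (I1 : s * s / (T * T) <= 2 * (s * s / (T ^ 2 + 1))).
  { apply Rmult_le_reg_r with (T * T * (T ^ 2 + 1)); [nra|].
    replace (s * s / (T * T) * (T * T * (T ^ 2 + 1))) with (s * s * (T * T + 1)) by (field; nra).
    replace (2 * (s * s / (T ^ 2 + 1)) * (T * T * (T ^ 2 + 1))) with (s * s * (2 * (T * T))) by (field; nra).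
    apply Rmult_le_compat_l; nra. }
  assert (I2 : 0 <= (al - s / T) * (al - s / T)) by apply Rle_0_sqr.
  replace ((al - s / T) * (al - s / T)) with (al * al - 2 * (al * s / T) + s * s / (T * T)) in I2
    by (field; lra).
  simpl in *. nra.
Qed.

Lemma CdB_space_iff (f : C -> C) : CdB_space t A mu f <->
  exists a, ex_series (fun n => Cmod (a n) ^ 2) /\
    transform t A (fun k => a k * RtoC (sqrt (mu k)))%C f.
Proof.
  split.
  - intros [Hf [a [Ha H]]]. exists a. split; [exact Ha|]. split; [exact Hf|].
    split; [now apply square_summable_wsum|].
    intros z Hz. destruct (H z Hz) as [s [Hs ->]]. f_equal. symmetry. now apply csum_unique.
  - intros [a [Ha (H1 & H2 & H3)]]. split; [exact H1|]. exists a. split; [exact Ha|].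
    intros z Hz. exists (CT t (fun k => a k * RtoC (sqrt (mu k)))%C z). split.
    + now apply CT_series; [apply data_point_seq|].
    + now apply H3.
Qed.

(** Since [beta] is bounded, the coefficients [a_k beta_k] remain square summable and [g] stays in
    the space. The predicate [V] records where the pairs come from and which target they are
    given. *)
Lemma space_transfer (f : C -> C) (c : R) (N : nat) (V : quad -> Prop) :
  CdB_space t A mu f -> nonzero f -> 0 < c ->
  (forall u, V u -> admissible t c N u /\ zero_pair f (qz u) (qw u)) ->
  (forall B, exists u, V u /\ far t B u) ->
  exists g, CdB_space t A mu g /\ nonzero g /\
    forall B, exists u, V u /\ B < Cmod (qs u) /\ g (qs u) = RtoC 0 /\
      (qs u = t (qn u) -> multiple_zero g (qs u)).
Proof.
  intros Hf Hnz Hc HV Hfar. apply CdB_space_iff in Hf. destruct Hf as [a [Ha Hf]].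
  assert (Hx := proj1 (transform_nonzero t data_point_seq A data_gen _ f Hf) Hnz).
  destruct (zeros_transfer t data_point_seq A data_gen c N Hc _ f Hf V HV Hfar Hx)
    as (beta & K & g & HK & Hb & Hg & Hgx & Hz).
  exists g. split; [|split].
  - apply CdB_space_iff. exists (fun k => a k * beta k)%C. split.
    + apply ex_series_dom with (K := K ^ 2) (2 := Ha). intro k. rewrite Cmod_mult.
      split; [apply pow_le, Rmult_le_pos; apply Cmod_ge_0|].
      rewrite Rpow_mult_distr, Rmult_comm. apply Rmult_le_compat_r; [apply pow_le, Cmod_ge_0|].
      apply pow_incr. split; [apply Cmod_ge_0|apply Hb].
    + replace (fun k => a k * beta k * RtoC (sqrt (mu k)))%C
        with (fun k => a k * RtoC (sqrt (mu k)) * beta k)%C; [exact Hg|].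
      apply functional_extensionality. intro k. ring.
  - exact (proj2 (transform_nonzero t data_point_seq A data_gen _ g Hg) Hgx).
  - intro B. destruct (Hz B) as (u & H1 & H2 & H3 & H4). exists u. repeat split; try assumption.
    apply (is_C_derive_unique g (qs u) (RtoC 0)). now apply H4.
Qed.

Lemma space_zeros_unbounded (f : C -> C) (P : C -> Prop) :
  CdB_space t A mu f -> nonzero f -> (forall z, P z -> f z = RtoC 0) ->
  ~ finite_set P -> forall B, exists z, P z /\ B < Cmod z.
Proof.
  intros Hf Hnz HP Hinf. apply CdB_space_iff in Hf. destruct Hf as [a [_ Hf]].
  destruct (proj1 (transform_nonzero t data_point_seq A data_gen _ f Hf) Hnz) as [m Hm].
  exact (zeros_unbounded t data_point_seq A data_gen _ f P m Hf Hm HP Hinf).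
Qed.

(** Apply separation at whichever of the two poles has the smaller power [|t|^N]: the triangle
    inequality then bounds [K] by the sum of two quantities, each below [K / 2]. *)
Lemma two_close (K : R) (N : nat) (v : C) (n k : nat) : separated t K N ->
  Cmod (v - t n) * Cmod (t n) ^ N < K / 2 -> Cmod (v - t k) * Cmod (t k) ^ N < K / 2 -> n = k.
Proof.
  intros Hs Hn Hk. apply NNPP. intro Hnk.
  assert (E1 := Hs n k ltac:(congruence)). assert (E2 := Hs k n Hnk).
  assert (D : Cmod (t n - t k) <= Cmod (v - t n) + Cmod (v - t k)).
  { replace (t n - t k)%C with ((v - t k) - (v - t n))%C by ring.
    rewrite Rplus_comm. apply Cmod_sub_le. }
  rewrite (Cmod_sub_sym (t k) (t n)) in E2.
  assert (Pn : 0 <= Cmod (v - t n)) by apply Cmod_ge_0.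
  assert (Pk : 0 <= Cmod (v - t k)) by apply Cmod_ge_0.
  assert (Tn := ht n). assert (Tk := ht k).
  assert (Qn : 0 < Cmod (t n) ^ N) by (apply pow_lt; lra).
  assert (Qk : 0 < Cmod (t k) ^ N) by (apply pow_lt; lra).
  destruct (Rle_or_lt (Cmod (t n) ^ N) (Cmod (t k) ^ N)); nra.
Qed.

(** A pole close to [v] has to be the centre, and it is within [K / 2] of [v], hence also far out.
    If no pole is close, any far pole will do. *)
Lemma center (K : R) (N : nat) (v : C) (B : R) : 0 < K -> separated t K N ->
  B + K <= Cmod v -> exists n, B <= Cmod (t n) /\ isolated t (K / 2) N n v.
Proof.
  intros HK Hs Hv.
  destruct (classic (exists n, Cmod (v - t n) * Cmod (t n) ^ N < K / 2)) as [[n Hn]|H].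
  - exists n. split.
    + assert (1 <= Cmod (t n) ^ N) by (apply pow_R1_Rle; specialize (ht n); lra).
      assert (P := Cmod_ge_0 (v - t n)). assert (E := Cmod_sub_ge v (t n)). nra.
    + intros k Hk. apply Rnot_lt_le. intro G. apply Hk. symmetry.
      now apply (two_close K N v n k).
  - destruct (proj2 (proj2 data_point_seq) B) as [L HL]. exists L.
    split; [left; apply HL; lia|]. intros k _. apply Rnot_lt_le. intro G. apply H. now exists k.
Qed.

Lemma i_implies_ii : localization_property t A mu ->
  exists S : C -> Prop, unbounded S /\
    forall f, CdB_space t A mu f -> nonzero f -> finite_set (fun z => zeros f z /\ S z).
Proof.
  intros (r & Hr & Hdis & Hlim & H).
  assert (Hn : forall n, Cmod (t n + RtoC (r n) - t n) = r n).
  { intro n. replace (t n + RtoC (r n) - t n)%C with (RtoC (r n)) by ring.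
    rewrite Cmod_R. apply Rabs_pos_eq. left. apply Hr. }
  exists (fun z => exists n, z = (t n + RtoC (r n))%C). split.
  - intro B. apply is_lim_seq_spec in Hlim. destruct (Hlim (mkposreal 1 Rlt_0_1)) as [L1 HL1].
    destruct (proj2 (proj2 data_point_seq) (B + 1)) as [L2 HL2].
    set (n := max L1 L2). exists (t n + RtoC (r n))%C. split; [now exists n|].
    specialize (HL1 n ltac:(lia)). specialize (HL2 n ltac:(lia)). simpl in HL1.
    rewrite Rminus_0_r in HL1.
    assert (E := Cmod_sub_ge (t n) (- RtoC (r n))%C). rewrite Cmod_opp, Cmod_R in E.
    replace (t n - - RtoC (r n))%C with (t n + RtoC (r n))%C in E by ring. lra.
  - intros f Hf Hnz. destruct (H f Hf Hnz) as [[l Hl] _]. exists l.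
    intros z [Hz [n ->]]. apply Hl. split; [exact Hz|]. intros [m Hm]. unfold disc in Hm.
    destruct (Nat.eq_dec m n) as [->|Hmn]; [rewrite Hn in Hm; lra|].
    (* Moving slightly towards [t n] enters the disc at [t n] while staying in the open disc at [t m]. *)
    set (s := Rmin (r n) ((r m - Cmod (t n + RtoC (r n) - t m)) / 2)).
    assert (Hs : 0 < s) by (apply Rmin_pos; [apply Hr|lra]).
    assert (Hs1 : s <= r n) by apply Rmin_l.
    assert (Hs2 : s <= (r m - Cmod (t n + RtoC (r n) - t m)) / 2) by apply Rmin_r.
    apply (Hdis m n Hmn (t n + RtoC (r n) - RtoC s)%C). unfold disc. split.
    + replace (t n + RtoC (r n) - RtoC s - t m)%C with (t n + RtoC (r n) - t m - RtoC s)%C by ring.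
      eapply Rle_lt_trans; [apply Cmod_sub_le|]. rewrite Cmod_R, Rabs_pos_eq; lra.
    + replace (t n + RtoC (r n) - RtoC s - t n)%C with (RtoC (r n - s)).
      * rewrite Cmod_R, Rabs_pos_eq; lra.
      * rewrite RtoC_minus. ring.
Qed.

Lemma ii_implies_iv (hsep : power_separated t) :
  (exists S : C -> Prop, unbounded S /\
    forall f, CdB_space t A mu f -> nonzero f -> finite_set (fun z => zeros f z /\ S z)) ->
  ~ exists f, CdB_space t A mu f /\ nonzero f /\ ~ finite_set (multiple_zero f).
Proof.
  intros (S & HS & H) (f & Hf & Hnz & Hinf).
  destruct (power_separated_nat t ht hsep) as (K & N & HK & Hsep).
  assert (Hub := space_zeros_unbounded f _ Hf Hnz (fun z Hz => proj1 Hz) Hinf).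
  (* A multiple zero serves as both members of its pair, and the target is a far point of [S]; the
     resulting [g] has zeros of arbitrarily large modulus in [S]. *)
  destruct (space_transfer f (K / 2) N
    (fun u => S (qs u) /\ qz u = qw u /\ multiple_zero f (qz u) /\ isolated t (K / 2) N (qn u) (qz u))
    Hf Hnz ltac:(lra)) as (g & Hg & Hgnz & Hgz).
  - intros u (_ & E & Hm & Hi). split; [split; [|rewrite <- E]; exact Hi|].
    right. apply multiple_zero_deriv in Hm; [|apply Hf]. tauto.
  - intro B. destruct (Hub (Rmax B 0 + K)) as [v [Hv1 Hv2]].
    assert (M := Rmax_l B 0).
    destruct (center K N v B HK Hsep ltac:(lra)) as [n [Hn1 Hn2]].
    destruct (HS B) as [s [Hs1 Hs2]].
    exists {| qz := v; qw := v; qn := n; qs := s |}. repeat split; simpl; try assumption; try lra.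
    + apply Hv1.
    + apply Hv1.
  - destruct (finite_bounded _ (H g Hg Hgnz)) as [B HB].
    destruct (Hgz B) as (u & (Hu & _) & Hu2 & Hu3 & _).
    specialize (HB (qs u) (conj Hu3 Hu)). lra.
Qed.

Lemma iv_implies_iii :
  ~ (exists f, CdB_space t A mu f /\ nonzero f /\ ~ finite_set (multiple_zero f)) ->
  forall (f : C -> C) (M : R), CdB_space t A mu f -> nonzero f -> 0 < M ->
    finite_set (fun z => zeros f z /\
      ~ exists n, disc (t n) (Rpower (Cmod (t n)) (- M)) z).
Proof.
  intros H f M Hf Hnz HM. apply NNPP. intro Hinf. apply H.
  set (P := fun z => _) in Hinf.
  assert (Hub := space_zeros_unbounded f P Hf Hnz (fun z Hz => proj1 Hz) Hinf).
  destruct (nfloor_ex M ltac:(lra)) as [n0 [_ Hn0]]. set (N := Datatypes.S n0).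
  (* Zeros outside all the discs are isolated from every pole, so the index of the centre can be
     chosen freely. *)
  assert (Hiso : forall z n, P z -> isolated t 1 N n z).
  { intros z n [_ Hz] k _.
    assert (D : Rpower (Cmod (t k)) (- M) <= Cmod (z - t k)).
    { apply Rnot_lt_le. intro G. apply Hz. now exists k. }
    specialize (ht k).
    assert (E := Rpower_neg_le (Cmod (t k)) M N ltac:(lra) ltac:(unfold N; rewrite S_INR; lra)).
    assert (Q : 0 < Cmod (t k) ^ N) by (apply pow_lt; lra).
    replace 1 with (/ Cmod (t k) ^ N * Cmod (t k) ^ N) by (field; lra).
    apply Rmult_le_compat_r; lra. }
  (* The target coincides with the centre [t (qn u)], which produces multiple zeros of [g] at poles
     of arbitrarily large modulus. *)
  destruct (space_transfer f 1 N
    (fun u => P (qz u) /\ P (qw u) /\ qz u <> qw u /\ qs u = t (qn u))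
    Hf Hnz ltac:(lra)) as (g & Hg & Hgnz & Hgz).
  - intros u (H1 & H2 & H3 & _). split; [split; now apply Hiso|]. left.
    split; [exact H3|]. split; [apply H1|apply H2].
  - intro B. destruct (Hub B) as [z [Hz1 Hz2]].
    destruct (Hub (Rmax B (Cmod z))) as [w [Hw1 Hw2]].
    assert (M1 := Rmax_l B (Cmod z)). assert (M2 := Rmax_r B (Cmod z)).
    destruct (proj2 (proj2 data_point_seq) B) as [n Hn]. specialize (Hn n (Nat.le_refl n)).
    exists {| qz := z; qw := w; qn := n; qs := t n |}.
    split; [|repeat split; simpl; lra].
    simpl. split; [exact Hz1|]. split; [exact Hw1|]. split; [|reflexivity]. intros ->. lra.
  - exists g. split; [exact Hg|]. split; [exact Hgnz|]. intro Hfin.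
    destruct (finite_bounded _ Hfin) as [B HB].
    destruct (Hgz B) as (u & (_ & _ & _ & Hs) & Hu2 & _ & Hu4).
    specialize (HB (qs u) (Hu4 Hs)). lra.
Qed.

Lemma iii_implies_i (hsep : power_separated t) :
  (forall (f : C -> C) (M : R), CdB_space t A mu f -> nonzero f -> 0 < M ->
    finite_set (fun z => zeros f z /\
      ~ exists n, disc (t n) (Rpower (Cmod (t n)) (- M)) z)) ->
  localization_property t A mu.
Proof.
  intro H. destruct (power_separated_nat t ht hsep) as (K & N & HK & Hsep).
  (* Because [|t n| >= 2], the [j] extra powers bring [r n * Cmod (t n) ^ N] below [K / 2]. One
     further power gives [r n <= / Cmod (t n)], hence [r -> 0], and makes [N1] positive. *)
  destruct (half_pow_small 1 (K / 4) ltac:(lra)) as [j Hj].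
  set (N1 := (N + j + 1)%nat).
  set (r := fun n => Rpower (Cmod (t n)) (- INR N1)).
  assert (Er : forall n, r n = / Cmod (t n) ^ N1).
  { intro n. unfold r. rewrite Rpower_Ropp, Rpower_pow; [reflexivity|]. specialize (ht n). lra. }
  assert (Hr : forall n, 0 < r n).
  { intro n. rewrite Er. apply Rinv_0_lt_compat, pow_lt. specialize (ht n). lra. }
  assert (Hr1 : forall n, r n <= / Cmod (t n)).
  { intro n. rewrite Er. specialize (ht n). apply Rinv_le_contravar; [lra|].
    rewrite <- (pow_1 (Cmod (t n))) at 1. apply Rle_pow; [lra|unfold N1; lia]. }
  assert (Hr2 : forall n, r n <= 1).
  { intro n. specialize (Hr1 n). specialize (ht n).
    assert (/ Cmod (t n) <= / 1) by (apply Rinv_le_contravar; lra). rewrite Rinv_1 in H0. lra. }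
  assert (HrK : forall n, r n * Cmod (t n) ^ N < K / 2).
  { intro n. rewrite Er. specialize (ht n). set (T := Cmod (t n)) in *.
    unfold N1. rewrite !pow_add, pow_1.
    assert (P1 : 0 < T ^ N) by (apply pow_lt; lra). assert (P2 : 0 < T ^ j) by (apply pow_lt; lra).
    replace (/ (T ^ N * T ^ j * T) * T ^ N) with (/ T ^ j * / T) by (field; lra).
    assert (Q : / T ^ j <= (1 / 2) ^ j).
    { rewrite <- pow_inv. apply pow_incr. split; [left; apply Rinv_0_lt_compat; lra|].
      replace (1 / 2) with (/ 2) by field. apply Rinv_le_contravar; lra. }
    assert (0 < / T ^ j) by (now apply Rinv_0_lt_compat).
    assert (/ T <= / 1) by (apply Rinv_le_contravar; lra). rewrite Rinv_1 in H1.
    assert (0 < / T) by (apply Rinv_0_lt_compat; lra). nra. }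
  (* The closed discs are needed here: the target [t n + r n] lies on the boundary circle. *)
  assert (Hclose : forall n v, Cmod (v - t n) <= r n -> Cmod (v - t n) * Cmod (t n) ^ N < K / 2).
  { intros n v Hv. eapply Rle_lt_trans; [|apply (HrK n)].
    apply Rmult_le_compat_r; [|exact Hv]. apply pow_le. apply Cmod_ge_0. }
  exists r. split; [exact Hr|]. split; [|split].
  - intros m n Hmn z [H1 H2]. apply Hmn. unfold disc in H1, H2.
    apply (two_close K N z m n Hsep); apply Hclose; lra.
  - apply is_lim_seq_spec. intro eps. assert (He := cond_pos eps).
    destruct (proj2 (proj2 data_point_seq) (/ eps)) as [L HL]. exists L. intros n Hn.
    specialize (HL n Hn). rewrite Rminus_0_r, Rabs_pos_eq by (left; apply Hr).
    eapply Rle_lt_trans; [apply Hr1|]. rewrite <- (Rinv_inv eps).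
    apply Rinv_lt_contravar; [|exact HL].
    apply Rmult_lt_0_compat; [now apply Rinv_0_lt_compat|]. specialize (ht n). lra.
  - intros f Hf Hnz. split.
    { apply H; try assumption. apply lt_0_INR. unfold N1. lia. }
    apply NNPP. intro Hinf.
    (* Two zeros in one disc are moved to its centre and to a boundary point. By [two_close] that
       boundary point lies in no other disc, so [g] has infinitely many zeros outside the discs of
       radius [|t_n|^(-N1)]. *)
    destruct (space_transfer f (K / 2) N
      (fun u => qz u <> qw u /\ f (qz u) = RtoC 0 /\ f (qw u) = RtoC 0 /\
         Cmod (qz u - t (qn u)) <= r (qn u) /\ Cmod (qw u - t (qn u)) <= r (qn u) /\
         qs u = (t (qn u) + RtoC (r (qn u)))%C)
      Hf Hnz ltac:(lra)) as (g & Hg & Hgnz & Hgz).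
    + intros u (H1 & H2 & H3 & H4 & H5 & _). split; [|left; tauto].
      split; intros k Hk; apply Rnot_lt_le; intro G; apply Hk; symmetry.
      * apply (two_close K N (qz u) (qn u) k Hsep); [now apply Hclose|exact G].
      * apply (two_close K N (qw u) (qn u) k Hsep); [now apply Hclose|exact G].
    + intro B.
      assert (HB : exists n, B + 1 < Cmod (t n) /\ ~ forall z w : C, zeros f z -> disc (t n) (r n) z ->
                          zeros f w -> disc (t n) (r n) w -> z = w).
      { apply NNPP. intro G. apply Hinf.
        destruct (proj2 (proj2 data_point_seq) (B + 1)) as [L HL]. exists (seq 0 L).
        intros n Hn. apply in_seq. split; [lia|]. apply Nat.nle_gt. intro Ln.
        apply G. exists n. split; [apply HL; lia|exact Hn]. }
      destruct HB as [n [Hn1 Hn2]].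
      assert (exists z w : C, z <> w /\ zeros f z /\ zeros f w /\ disc (t n) (r n) z /\ disc (t n) (r n) w)
        as (z & w & Hzw & Hz & Hw & Dz & Dw).
      { apply NNPP. intro G. apply Hn2. intros z w Hz Dz Hw Dw. apply NNPP. intro E.
        apply G. exists z, w. tauto. }
      assert (Near : forall v, Cmod (v - t n) <= r n -> B <= Cmod v).
      { intros v Hv. assert (E := Cmod_sub_ge (t n) v). rewrite Cmod_sub_sym in E.
        specialize (Hr2 n). lra. }
      exists {| qz := z; qw := w; qn := n; qs := (t n + RtoC (r n))%C |}.
      unfold disc in Dz, Dw. unfold far. simpl. split.
      * split; [exact Hzw|]. repeat split; try assumption; lra.
      * split; [apply Near; lra|]. split; [apply Near; lra|]. split; [lra|].
        apply Near. replace (t n + RtoC (r n) - t n)%C with (RtoC (r n)) by ring.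
        rewrite Cmod_R, Rabs_pos_eq; [lra|]. left. apply Hr.
    + destruct (finite_bounded _ (H g (INR N1) Hg Hgnz ltac:(apply lt_0_INR; unfold N1; lia)))
        as [B HB].
      destruct (Hgz B) as (u & (_ & _ & _ & _ & _ & Hs) & Hu2 & Hu3 & _).
      assert (Hr0 := Hr (qn u)).
      assert (E : Cmod (qs u - t (qn u)) = r (qn u)).
      { rewrite Hs. replace (t (qn u) + RtoC (r (qn u)) - t (qn u))%C with (RtoC (r (qn u))) by ring.
        rewrite Cmod_R, Rabs_pos_eq; lra. }
      specialize (HB (qs u)). apply (Rlt_irrefl B). eapply Rlt_trans; [exact Hu2|]. apply HB.
      split; [exact Hu3|]. intros [m Hm]. unfold disc in Hm. fold (r m) in Hm.
      assert (qn u = m) as Em.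
      { apply (two_close K N (qs u) (qn u) m Hsep); apply Hclose; lra. }
      rewrite <- Em, E in Hm. lra.
Qed.

End Equivalences.

Theorem theorem1p1 (t : nat -> C) (A : C -> C) (mu : nat -> R)
    (hdata : CdB_data t A mu) (hsep : power_separated t)
    (ht : forall n : nat, 2 <= Cmod (t n)) (hA : finite_order A) :
  let stmt_i := localization_property t A mu in
  let stmt_ii :=
    exists S : C -> Prop, unbounded S /\
      forall f : C -> C, CdB_space t A mu f -> nonzero f ->
        finite_set (fun z => zeros f z /\ S z) in
  let stmt_iii :=
    forall (f : C -> C) (M : R), CdB_space t A mu f -> nonzero f -> 0 < M ->
      finite_set (fun z => zeros f z /\
        ~ exists n : nat, disc (t n) (Rpower (Cmod (t n)) (- M)) z) in
  let stmt_iv :=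
    ~ exists f : C -> C, CdB_space t A mu f /\ nonzero f /\
        ~ finite_set (multiple_zero f) in
  (stmt_i <-> stmt_ii) /\ (stmt_i <-> stmt_iii) /\ (stmt_i <-> stmt_iv).
Proof.
  intros stmt_i stmt_ii stmt_iii stmt_iv.
  assert (H12 : stmt_i -> stmt_ii) by exact (i_implies_ii t A mu hdata ht).
  assert (H24 : stmt_ii -> stmt_iv) by exact (ii_implies_iv t A mu hdata ht hsep).
  assert (H43 : stmt_iv -> stmt_iii) by exact (iv_implies_iii t A mu hdata ht).
  assert (H31 : stmt_iii -> stmt_i) by exact (iii_implies_i t A mu hdata ht hsep).
  clearbody stmt_i stmt_ii stmt_iii stmt_iv. tauto.
Qed.
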